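(* Let $X$ be a complex Banach space, $R>0$, $k\in\mathbb{Z}$ and $0\le i\le n\le p$ be integers. Let $\hat T_k\in\hat{\mathscr D}'_{(k)}(B_R(\mathbf 0)\times\mathbb{R};X)$ and $\hat S_{k+n-2i}\in\hat{\mathscr D}'_{(k+n-2i)}(B_R(\mathbf 0)\times\mathbb{R};X)$. The distribution $\hat S_{k+n-2i}$ is the distributional derivative $\partial_{\overline\zeta}^{\,n-i}\partial_\zeta^{\,i}\partial_z^{p-n}\hat T_k$ of $\hat T_k$ (in the convention specified in the context) if and only if $$(-1)^p\big(\hat T_k,\partial_{\overline\zeta}^{\,i}\partial_\zeta^{\,n-i}\partial_z^{p-n}\hat\phi_{k+n-2i}\big)=\big(\hat S_{k+n-2i},\hat\phi_{k+n-2i}\big)$$ for all $\hat\phi_{k+n-2i}\in\hat{\mathscr D}_{(k+n-2i)}(B_R(\mathbf 0)\times\mathbb{R};\mathbb{C})$, and this condition holds if and only if $$(-1)^p\big(T_k,2^{-\frac n2}\mathcal{D}_{-k+i}^{\,i}\mathcal{D}_{k+n-2i}^{\,n-i}\partial_z^{p-n}\phi_{k+n-2i}\big)=\big(S_{k+n-2i},\phi_{k+n-2i}\big)$$ for all $\phi_{k+n-2i}\in\mathscr D_{(k+n-2i)}([0,R)\times\mathbb{R};\mathbb{C})$.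
   Context: $B_R(\mathbf 0)$ is the open ball of radius $R$ in $\mathbb{R}^2$; $\partial_\zeta:=\frac1{\sqrt2}(\partial_x-\mathrm{i}\partial_y)$, $\partial_{\overline\zeta}:=\frac1{\sqrt2}(\partial_x+\mathrm{i}\partial_y)$. For $j\in\mathbb{Z}$, $\mathcal{D}_j:=\frac{\partial}{\partial r}+\frac jr$ and $\mathcal{D}_j^n:=\mathcal{D}_{j-(n-1)}\cdots\mathcal{D}_{j-1}\mathcal{D}_j$. A mode $j$ function is of the form $\hat\phi_j(r\cos\theta,r\sin\theta,z)=\mathrm{e}^{\mathrm{i}j\theta}\phi_j(r,z)$ with $\phi_j(0,z)=0$ if $j\ne0$; $\phi_j$ is its radial coefficient. $\mathscr D(B_R(\mathbf 0)\times\mathbb{R};\mathbb{C})$ is the space of smooth compactly supported functions and $\hat{\mathscr D}_{(j)}(B_R(\mathbf 0)\times\mathbb{R};\mathbb{C})$ is its subspace of mode $j$ functions; $\mathscr D_{(j)}([0,R)\times\mathbb{R};\mathbb{C})$ is the space of their radial coefficients, i.e. of functions $\phi$ with compact support in $[0,R)\times\mathbb{R}$ such that $\mathcal{D}_{-j+i}^{\,n-i}\mathcal{D}_j^{\,i}\partial_z^{p-n}\phi$ extends continuously to $[0,R)\times\mathbb{R}$ and $(j+n-2i)\mathcal{D}_{-j+i}^{\,n-i}\mathcal{D}_j^{\,i}\partial_z^{p-n}\phi|_{r=0}=0$ for all $0\le i\le n\le p$. A mode $j$ distribution $\hat T_j\in\hat{\mathscr D}'_{(j)}(B_R(\mathbf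 0)\times\mathbb{R};X)$ is a sequentially continuous linear map $\hat{\mathscr D}_{(j)}(B_R(\mathbf 0)\times\mathbb{R};\mathbb{C})\to X$, where a sequence converges if all supports lie in a common compact subset $\overline B_{r_0}(\mathbf 0)\times[-z_0,z_0]$ (with $0<r_0<R$, $z_0>0$) and all derivatives converge uniformly there. It induces the radial distribution $T_j:\mathscr D_{(j)}([0,R)\times\mathbb{R};\mathbb{C})\to X$, $(T_j,\phi_j):=(\hat T_j,\hat\phi_j)$, and it is extended to a distribution on $\mathscr D(B_R(\mathbf 0)\times\mathbb{R};\mathbb{C})$ by $(\hat T_j,\hat\phi):=(\hat T_j,\hat\phi_j)$, where $\hat\phi_j$ is the mode $j$ function with radial coefficient $\phi_j(r,z)=\frac1{2\pi}\int_0^{2\pi}\hat\phi(r\cos\theta,r\sin\theta,z)\mathrm{e}^{-\mathrm{i}j\theta}\,\mathrm d\theta$. Convention: $\hat S_{k+n-2i}$ is called the distributional derivative $\partial_{\overline\zeta}^{\,n-i}\partial_\zeta^{\,i}\partial_z^{p-n}\hat T_k$ if the extended distributions satisfy $(-1)^p(\hat T_k,\partial_{\overline\zeta}^{\,i}\partial_\zeta^{\,n-i}\partial_z^{p-n}\hat\phi)=(\hat S_{k+n-2i},\hat\phi)$ for all $\hat\phi\in\mathscr D(B_R(\mathbf 0)\times\mathbb{R};\mathbb{C})$. *)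

(* Defs.v *)
From Stdlib Require Export Reals ZArith.
From Coquelicot Require Export Coquelicot.
Open Scope R_scope.

(** * Complex-valued functions on R^3

    Functions with compact support in [B_rad(0) x R] (resp. [[0,rad) x R]) are
    identified with their extensions by zero to all of R^3 (resp. to [0 <= r]). *)

Definition R3 : Type := (R * R * R)%type.

Definition cderive (f : R -> C) (t : R) : C :=
  (Derive (fun s => Re (f s)) t, Derive (fun s => Im (f s)) t).

Definition ex_cderive (f : R -> C) (t : R) : Prop :=
  ex_derive (K := R_AbsRing) (V := C_R_NormedModule) f t.

Definition dx (f : R3 -> C) : R3 -> C :=
  fun '(x, y, z) => cderive (fun t => f (t, y, z)) x.
Definition dy (f : R3 -> C) : R3 -> C :=
  fun '(x, y, z) => cderive (fun t => f (x, t, z)) y.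
Definition dz (f : R3 -> C) : R3 -> C :=
  fun '(x, y, z) => cderive (fun t => f (x, y, t)) z.

Definition dzeta (f : R3 -> C) : R3 -> C :=
  fun q => (RtoC (/ sqrt 2) * (dx f q - Ci * dy f q))%C.
Definition dzetabar (f : R3 -> C) : R3 -> C :=
  fun q => (RtoC (/ sqrt 2) * (dx f q + Ci * dy f q))%C.

Definition partials_exist (f : R3 -> C) : Prop :=
  forall x y z,
    ex_cderive (fun t => f (t, y, z)) x /\
    ex_cderive (fun t => f (x, t, z)) y /\
    ex_cderive (fun t => f (x, y, t)) z.

Fixpoint class_C (m : nat) (f : R3 -> C) : Prop :=
  (forall q : R3, continuous f q) /\
  match m with
  | O => True
  | S m' => partials_exist f /\
            class_C m' (dx f) /\ class_C m' (dy f) /\ class_C m' (dz f)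
  end.

Definition smooth (f : R3 -> C) : Prop := forall m, class_C m f.

Definition in_cyl (r0 z0 : R) (q : R3) : Prop :=
  let '(x, y, z) := q in sqrt (x ^ 2 + y ^ 2) <= r0 /\ Rabs z <= z0.

(** As [in_cyl r0 z0] is closed, this says that it contains the support. *)
Definition supported_in (r0 z0 : R) (f : R3 -> C) : Prop :=
  forall q, ~ in_cyl r0 z0 q -> f q = RtoC 0.

Definition test_function (rad : R) (f : R3 -> C) : Prop :=
  smooth f /\
  exists r0 z0, 0 < r0 < rad /\ 0 < z0 /\ supported_in r0 z0 f.

Definition cis (t : R) : C := (cos t, sin t).

Definition is_mode (j : Z) (f : R3 -> C) : Prop :=
  exists phi : R * R -> C,
    (forall r t z, 0 <= r ->
       f (r * cos t, r * sin t, z) = (cis (IZR j * t) * phi (r, z))%C) /\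
    (j <> 0%Z -> forall z, phi (0, z) = RtoC 0).

Definition mode_test_function (rad : R) (j : Z) (f : R3 -> C) : Prop :=
  test_function rad f /\ is_mode j f.

(** * Radial coefficients: functions of [(r, z)]; values at [r < 0] are never used *)

(** Polar angle in [(-PI, PI]]; its value at the origin is irrelevant below. *)
Definition polar_angle (x y : R) : R :=
  let a := acos (x / sqrt (x ^ 2 + y ^ 2)) in
  if Rle_dec 0 y then a else - a.

(** The function [(r cos t, r sin t, z) |-> exp (i j t) phi (r, z)]. *)
Definition mode_function (j : Z) (phi : R * R -> C) : R3 -> C :=
  fun '(x, y, z) =>
    (cis (IZR j * polar_angle x y) * phi (sqrt (x ^ 2 + y ^ 2), z))%C.

Definition mode_coef (j : Z) (f : R3 -> C) : R * R -> C :=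
  fun '(r, z) =>
    (RtoC (/ (2 * PI)) *
     RInt (V := C_R_CompleteNormedModule)
       (fun t => f (r * cos t, r * sin t, z)%R * cis (- (IZR j * t)))
       0 (2 * PI))%C.

Definition mode_part (j : Z) (f : R3 -> C) : R3 -> C :=
  mode_function j (mode_coef j f).

Definition drad (phi : R * R -> C) : R * R -> C :=
  fun '(r, z) => cderive (fun s => phi (s, z)) r.
Definition dax (phi : R * R -> C) : R * R -> C :=
  fun '(r, z) => cderive (fun s => phi (r, s)) z.

(** [Dop j] is the operator d/dr + j/r, meaningful for [r > 0] only. *)
Definition Dop (j : Z) (phi : R * R -> C) : R * R -> C :=
  fun '(r, z) => (drad phi (r, z) + RtoC (IZR j / r) * phi (r, z))%C.

Fixpoint Dop_iter (m : nat) (j : Z) (phi : R * R -> C) : R * R -> C :=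
  match m with
  | O => phi
  | S m' => Dop_iter m' (j - 1) (Dop j phi)
  end.

(** Extension of a function on [r > 0] to the axis by its limit at [r = 0+]. *)
Definition axis_ext (phi : R * R -> C) : R * R -> C :=
  fun '(r, z) =>
    if Rlt_dec 0 r then phi (r, z)
    else lim (T := C_R_CompleteNormedModule)
             (filtermap (fun s => phi (s, z)) (at_right 0)).

Definition open_strip (rad : R) (q : R * R) : Prop := 0 < fst q < rad.
Definition half_strip (rad : R) (q : R * R) : Prop := 0 <= fst q < rad.

Fixpoint class_C_strip (rad : R) (m : nat) (phi : R * R -> C) : Prop :=
  (forall q : R * R, open_strip rad q -> continuous phi q) /\
  match m with
  | O => True
  | S m' =>
      (forall r z, 0 < r < rad ->
         ex_cderive (fun s => phi (s, z)) r /\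
         ex_cderive (fun s => phi (r, s)) z) /\
      class_C_strip rad m' (drad phi) /\ class_C_strip rad m' (dax phi)
  end.

(** The continuous extension of [D_{-j+i}^{n-i} D_j^i dz^{p-n} phi]. *)
Definition radial_deriv (j : Z) (i n p : nat) (phi : R * R -> C) : R * R -> C :=
  axis_ext (Dop_iter (n - i) (- j + Z.of_nat i)
             (Dop_iter i j (Nat.iter (p - n) dax phi))).

(** The clause [continuous_on _ phi] says that the value of [phi] itself on the
    axis is that of its continuous extension. *)
Definition radial_test_function (rad : R) (j : Z) (phi : R * R -> C) : Prop :=
  (exists r0 z0, 0 < r0 < rad /\ 0 < z0 /\
     forall r z, 0 <= r -> r0 < r \/ z0 < Rabs z -> phi (r, z) = RtoC 0) /\
  (forall m, class_C_strip rad m phi) /\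
  continuous_on (half_strip rad) phi /\
  forall i n p : nat, (i <= n)%nat -> (n <= p)%nat ->
    continuous_on (half_strip rad) (radial_deriv j i n p phi) /\
    forall z,
      (RtoC (IZR (j + Z.of_nat n - 2 * Z.of_nat i))
       * radial_deriv j i n p phi (0, z))%C = RtoC 0.

(** * Mode distributions *)

Definition dmixed (a b c : nat) (f : R3 -> C) : R3 -> C :=
  Nat.iter a dx (Nat.iter b dy (Nat.iter c dz f)).

Definition test_converges (rad : R) (fs : nat -> R3 -> C) (f : R3 -> C) : Prop :=
  exists r0 z0, 0 < r0 < rad /\ 0 < z0 /\
    (forall m, supported_in r0 z0 (fs m)) /\ supported_in r0 z0 f /\
    forall (a b c : nat) (eps : R), 0 < eps ->
      exists N : nat, forall m q, (N <= m)%nat -> in_cyl r0 z0 q ->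
        Cmod (dmixed a b c (fs m) q - dmixed a b c f q) < eps.

(** A distribution is represented by a total map on functions, of which only
    the values on mode [j] test functions matter. *)
Record mode_distribution (rad : R) (j : Z) (X : CompleteNormedModule C_AbsRing) :
  Type := {
  dist_map :> (R3 -> C) -> X;
  dist_linear : forall (a b : C) (f g : R3 -> C),
    mode_test_function rad j f -> mode_test_function rad j g ->
    dist_map (fun q => (a * f q + b * g q)%C)
    = plus (scal a (dist_map f)) (scal b (dist_map g));
  dist_continuous : forall (fs : nat -> R3 -> C) (f : R3 -> C),
    (forall m, mode_test_function rad j (fs m)) -> mode_test_function rad j f ->
    test_converges rad fs f ->
    filterlim (fun m => dist_map (fs m)) eventually (locally (dist_map f))
}.

Arguments dist_map {rad j X} _ _.

Definition radial_dist {rad : R} {j : Z} {X : CompleteNormedModule C_AbsRing}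
  (T : mode_distribution rad j X) (phi : R * R -> C) : X :=
  T (mode_function j phi).

(** Extension of a mode [j] distribution to all test functions. *)
Definition ext_dist {rad : R} {j : Z} {X : CompleteNormedModule C_AbsRing}
  (T : mode_distribution rad j X) (f : R3 -> C) : X :=
  T (mode_part j f).

Definition zeta_deriv (i n p : nat) (f : R3 -> C) : R3 -> C :=
  Nat.iter i dzetabar (Nat.iter (n - i) dzeta (Nat.iter (p - n) dz f)).

Definition target_mode (k : Z) (i n : nat) : Z :=
  (k + Z.of_nat n - 2 * Z.of_nat i)%Z.

Definition sign_pow (p : nat) : C := RtoC ((-1) ^ p).

(** [S] is the distributional derivative
    [dzetabar^(n-i) dzeta^i dz^(p-n)] of [T]; note that the powers [i] and
    [n - i] are exchanged on the test function. *)
Definition is_distributional_derivative {rad : R} {k : Z}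
  {X : CompleteNormedModule C_AbsRing} (i n p : nat)
  (T : mode_distribution rad k X)
  (S : mode_distribution rad (target_mode k i n) X) : Prop :=
  forall f, test_function rad f ->
    scal (sign_pow p) (ext_dist T (zeta_deriv i n p f)) = ext_dist S f.

(* Main.v *)
Require Import Defs.
From Stdlib Require Import Reals ZArith Lra Lia FunctionalExtensionality Classical ClassicalEpsilon.
From Coquelicot Require Import Coquelicot.
Open Scope R_scope.

(** The projection of a test function [f] on mode [j] is the rotation average
    [(1 / 2 pi) int_0^{2 pi} exp (- i j t) f (R_t q) dt]. Differentiating under
    the integral shows that it preserves smoothness and that [dzeta] and
    [dzetabar] intertwine the projections on modes [j] and [j - 1], [j + 1];
    this gives the first equivalence.

    Off the axis, [dzeta] and [dzetabar] act on [exp (i j theta) phi] as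
    [D_j] and [D_{-j}] act on [phi], up to the factor [2^{-1/2}]. For a radial
    test function [phi] the mode functions [G a b c] with coefficients
    [D_{-j+a}^b D_j^a dz^c phi] are continuous on R^3, axis included, and since
    [D_{1-l} D_l = D_{1+l} D_{-l}] the partial derivatives of each of them are
    combinations of others off the axis. Continuity carries these identities
    across the axis, so all [G a b c] are smooth. Conversely, the radial
    coefficient of a mode [j] test function [f] is [f (r, 0, z)]. *)

(** [polar_angle] jumps across a half-plane and the operators D_j are singular at r = 0, so
    smoothness cannot be read off from [mode_part] and [mode_function] as defined. Two
    reformulations avoid both defects. A mode j function is one with f (R_t q) = exp (i j t) f q, a
    condition free of angles and coefficients; the rotation average projects onto such functions,
    and each of them is its own average. That a derivative of a mode function has a shifted mode,
    and vanishes on the axis when that mode is not 0, then follows from the intertwining alone. In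
    the other direction everything rests on the normal form D_{-j+a}^b D_j^a dz^c: its mode is j - a
    + b, and for a = i, b = n - i this is the number j + n - 2 i in the definition of radial test
    functions. The vanishing condition there is thus exactly what makes exp (i l theta) times the
    coefficient continuous on the axis when l <> 0. Restriction to y = 0, x >= 0 and multiplication
    by exp (i j theta) are inverse to each other on the two spaces of test functions, so the second
    equivalence becomes a substitution. *)

Lemma C_eq (a b : C) : fst a = fst b -> snd a = snd b -> a = b.
Proof. destruct a, b; simpl; intros -> ->; reflexivity. Qed.

(** * Differentiation and continuity of complex-valued functions *)

Definition is_cderive (f : R -> C) (t : R) (l : C) : Prop :=
  is_derive (fun s => fst (f s)) t (fst l) /\
  is_derive (fun s => snd (f s)) t (snd l).

(** Links the componentwise derivative, to which the real theorems apply, with differentiability in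
    the normed module [C], which [class_C] asks for. The way back is [ex_cderive_is]. *)
Lemma is_cderive_ex (f : R -> C) (t : R) (l : C) :
  is_cderive f t l -> ex_cderive f t.
Proof.
  intros [H1 H2]. exists l.
  apply (filterdiff_ext (V := C_R_NormedModule) (fun s => (fst (f s), snd (f s)))).
  { intros s. destruct (f s); reflexivity. }
  apply (filterdiff_ext_lin (V := C_R_NormedModule) _
           (fun y : R => (scal y (fst l), scal y (snd l))));
    [| intros y; destruct l; reflexivity].
  refine (filterdiff_comp_2 (W := C_R_NormedModule) (fun s => fst (f s))
           (fun s => snd (f s)) (fun a b => (a, b)) _ _ (fun a b => (a, b)) H1 H2 _).
  apply (filterdiff_ext (fun u => u)); [intros [x y]; reflexivity |].
  apply (filterdiff_ext_lin _ (fun u => u)); [| intros [x y]; reflexivity].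
  apply filterdiff_id.
Qed.

Lemma is_cderive_unique (f : R -> C) (t : R) (l : C) :
  is_cderive f t l -> cderive f t = l.
Proof.
  intros [H1 H2]. apply C_eq; unfold cderive, Re, Im; simpl;
    apply is_derive_unique; assumption.
Qed.

Lemma ex_cderive_is (f : R -> C) (t : R) :
  ex_cderive f t -> is_cderive f t (cderive f t).
Proof.
  intros [l H].
  assert (E : is_cderive f t l).
  { split.
    - refine (filterdiff_ext_lin _ _ _ (filterdiff_comp (V := C_R_NormedModule)
        (W := R_NormedModule) f (fun p => fst p) _ (fun p => fst p) H _) _).
      + apply filterdiff_linear, (is_linear_fst (U := R_NormedModule) (V := R_NormedModule)).
      + reflexivity.
    - refine (filterdiff_ext_lin _ _ _ (filterdiff_comp (V := C_R_NormedModule)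
        (W := R_NormedModule) f (fun p => snd p) _ (fun p => snd p) H _) _).
      + apply filterdiff_linear, (is_linear_snd (U := R_NormedModule) (V := R_NormedModule)).
      + reflexivity. }
  rewrite (is_cderive_unique _ _ _ E). exact E.
Qed.

Lemma is_cderive_ext_loc (f g : R -> C) (t : R) (l : C) :
  locally t (fun s => f s = g s) -> is_cderive f t l -> is_cderive g t l.
Proof.
  intros He [H1 H2]. split.
  - refine (is_derive_ext_loc _ _ _ _ _ H1).
    revert He; apply filter_imp; intros s ->; reflexivity.
  - refine (is_derive_ext_loc _ _ _ _ _ H2).
    revert He; apply filter_imp; intros s ->; reflexivity.
Qed.

Lemma is_cderive_ext (f g : R -> C) (t : R) (l : C) :
  (forall s, f s = g s) -> is_cderive f t l -> is_cderive g t l.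
Proof. intros He. apply is_cderive_ext_loc, filter_forall, He. Qed.

Lemma is_cderive_const (a : C) (t : R) : is_cderive (fun _ => a) t (RtoC 0).
Proof. split; apply (is_derive_const (K := R_AbsRing) (V := R_NormedModule)). Qed.

Lemma is_cderive_plus (f g : R -> C) (t : R) (a b : C) :
  is_cderive f t a -> is_cderive g t b ->
  is_cderive (fun s => f s + g s)%C t (a + b)%C.
Proof. intros [F1 F2] [G1 G2]. split; apply (is_derive_plus (K := R_AbsRing) (V := R_NormedModule)); assumption. Qed.

Lemma is_derive_Rmult (f g : R -> R) (t a b : R) :
  is_derive f t a -> is_derive g t b ->
  is_derive (fun s => f s * g s) t (a * g t + f t * b).
Proof.
  intros F G. apply (is_derive_mult (K := R_AbsRing) f g t a b F G).
  intros; apply Rmult_comm.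
Qed.

Lemma is_cderive_mult (f g : R -> C) (t : R) (a b : C) :
  is_cderive f t a -> is_cderive g t b ->
  is_cderive (fun s => f s * g s)%C t (a * g t + f t * b)%C.
Proof.
  intros [F1 F2] [G1 G2]. split; simpl.
  - replace (_ + _) with ((fst a * fst (g t) + fst (f t) * fst b)
      - (snd a * snd (g t) + snd (f t) * snd b)) by ring.
    apply (is_derive_minus (K := R_AbsRing) (V := R_NormedModule)); apply is_derive_Rmult; assumption.
  - replace (_ + _) with ((fst a * snd (g t) + fst (f t) * snd b)
      + (snd a * fst (g t) + snd (f t) * fst b)) by ring.
    apply (is_derive_plus (K := R_AbsRing) (V := R_NormedModule)); apply is_derive_Rmult; assumption.
Qed.

Lemma is_cderive_lin (c d : C) (f g : R -> C) (t : R) (a b : C) :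
  is_cderive f t a -> is_cderive g t b ->
  is_cderive (fun s => c * f s + d * g s)%C t (c * a + d * b)%C.
Proof.
  intros F G.
  replace (c * a + d * b)%C
    with ((RtoC 0 * f t + c * a) + (RtoC 0 * g t + d * b))%C by ring.
  apply is_cderive_plus; apply (is_cderive_mult (fun _ => _));
    auto using is_cderive_const.
Qed.

Lemma is_cderive_cst_mult (c : C) (f : R -> C) (t : R) (a : C) :
  is_cderive f t a -> is_cderive (fun s => c * f s)%C t (c * a)%C.
Proof.
  intros F. replace (c * a)%C with (RtoC 0 * f t + c * a)%C by ring.
  apply (is_cderive_mult (fun _ => c)); auto using is_cderive_const.
Qed.

Lemma is_cderive_RtoC (f : R -> R) (t l : R) :
  is_derive f t l -> is_cderive (fun s => RtoC (f s)) t (RtoC l).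
Proof.
  intros F. split; [exact F | exact (is_derive_const (K := R_AbsRing) (V := R_NormedModule) 0 t)].
Qed.

Lemma ccontinuous_pair {U : UniformSpace} (f : U -> C) (q : U) :
  continuous (fun u => fst (f u)) q -> continuous (fun u => snd (f u)) q ->
  continuous f q.
Proof.
  intros H1 H2.
  apply (continuous_ext (fun u => (fst (f u), snd (f u)) : C));
    [intros u; destruct (f u); reflexivity |].
  apply (continuous_comp_2 (fun u => fst (f u)) (fun u => snd (f u))
    (fun a b => (a, b) : C) q H1 H2).
  apply (continuous_ext (fun u => u)); [intros [a b]; reflexivity |].
  apply continuous_id.
Qed.

Lemma ccontinuous_fst {U : UniformSpace} (f : U -> C) (q : U) :
  continuous f q -> continuous (fun u => fst (f u)) q.
Proof.
  intros H. apply (continuous_comp f (fun p : C => fst p) q H).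
  destruct (f q); apply continuous_fst.
Qed.

Lemma ccontinuous_snd {U : UniformSpace} (f : U -> C) (q : U) :
  continuous f q -> continuous (fun u => snd (f u)) q.
Proof.
  intros H. apply (continuous_comp f (fun p : C => snd p) q H).
  destruct (f q); apply continuous_snd.
Qed.

Lemma ccontinuous_plus {U : UniformSpace} (f g : U -> C) (q : U) :
  continuous f q -> continuous g q -> continuous (fun u => f u + g u)%C q.
Proof.
  intros F G. apply ccontinuous_pair; simpl;
    apply (continuous_plus (V := R_NormedModule));
    auto using ccontinuous_fst, ccontinuous_snd.
Qed.

Lemma ccontinuous_mult {U : UniformSpace} (f g : U -> C) (q : U) :
  continuous f q -> continuous g q -> continuous (fun u => f u * g u)%C q.
Proof.
  intros F G. apply ccontinuous_pair; simpl.
  - apply (continuous_minus (V := R_NormedModule)); apply (continuous_mult (K := R_AbsRing));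
    auto using ccontinuous_fst, ccontinuous_snd.
  - apply (continuous_plus (V := R_NormedModule)); apply (continuous_mult (K := R_AbsRing));
    auto using ccontinuous_fst, ccontinuous_snd.
Qed.

Lemma ccontinuous_RtoC {U : UniformSpace} (f : U -> R) (q : U) :
  continuous f q -> continuous (fun u => RtoC (f u)) q.
Proof. intros F. apply ccontinuous_pair; simpl; [exact F | apply continuous_const]. Qed.

Lemma ccontinuous_lin {U : UniformSpace} (c d : C) (f g : U -> C) (q : U) :
  continuous f q -> continuous g q -> continuous (fun u => c * f u + d * g u)%C q.
Proof.
  intros F G. apply ccontinuous_plus; apply ccontinuous_mult;
    auto using continuous_const.
Qed.

(** * Partial derivatives on R^3 *)

Definition has_partials_at (q : R3) (f : R3 -> C) (fx fy fz : C) : Prop :=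
  let '(x, y, z) := q in
  is_cderive (fun t => f (t, y, z)) x fx /\
  is_cderive (fun t => f (x, t, z)) y fy /\
  is_cderive (fun t => f (x, y, t)) z fz.

Definition has_partials (f fx fy fz : R3 -> C) : Prop :=
  forall q, has_partials_at q f (fx q) (fy q) (fz q).

Lemma has_partials_at_unique (q : R3) (f : R3 -> C) (fx fy fz : C) :
  has_partials_at q f fx fy fz -> dx f q = fx /\ dy f q = fy /\ dz f q = fz.
Proof.
  destruct q as [[x y] z]. intros (Hx & Hy & Hz).
  repeat split; apply is_cderive_unique; assumption.
Qed.

Lemma has_partials_unique (f fx fy fz : R3 -> C) :
  has_partials f fx fy fz -> dx f = fx /\ dy f = fy /\ dz f = fz.
Proof.
  intros H.
  repeat split; apply functional_extensionality; intros q;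
    apply (has_partials_at_unique q f (fx q) (fy q) (fz q) (H q)).
Qed.

Lemma class_C_continuous (m : nat) (f : R3 -> C) :
  class_C m f -> forall q : R3, continuous f q.
Proof. destruct m; intros H; apply H. Qed.

(** Since [Derive] is total, known partial derivatives identify [dx f], [dy f] and [dz f] as
    functions; the recursion of [class_C] can then run on closed forms. *)
Lemma class_C_intro (m : nat) (f fx fy fz : R3 -> C) :
  (forall q : R3, continuous f q) -> has_partials f fx fy fz ->
  class_C m fx -> class_C m fy -> class_C m fz -> class_C (S m) f.
Proof.
  intros Hc Hp Hx Hy Hz.
  destruct (has_partials_unique _ _ _ _ Hp) as (Ex & Ey & Ez).
  split; [exact Hc |]. rewrite Ex, Ey, Ez. split; [| auto].
  intros x y z. destruct (Hp (x, y, z)) as (Px & Py & Pz).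
  repeat split; eapply is_cderive_ex; eassumption.
Qed.

Lemma class_C_partials (m : nat) (f : R3 -> C) :
  class_C (S m) f -> has_partials f (dx f) (dy f) (dz f).
Proof.
  intros (_ & Hp & _) [[x y] z]. destruct (Hp x y z) as (Px & Py & Pz).
  split; [| split]; apply ex_cderive_is; assumption.
Qed.

Lemma has_partials_lin (c d : C) (f fx fy fz g gx gy gz : R3 -> C) :
  has_partials f fx fy fz -> has_partials g gx gy gz ->
  has_partials (fun q => c * f q + d * g q)%C
    (fun q => c * fx q + d * gx q)%C (fun q => c * fy q + d * gy q)%C
    (fun q => c * fz q + d * gz q)%C.
Proof.
  intros F G [[x y] z]. destruct (F (x, y, z)) as (Fx & Fy & Fz).
  destruct (G (x, y, z)) as (Gx & Gy & Gz).
  split; [| split]; apply is_cderive_lin; assumption.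
Qed.

Lemma class_C_lin (m : nat) (c d : C) (f g : R3 -> C) :
  class_C m f -> class_C m g -> class_C m (fun q => c * f q + d * g q)%C.
Proof.
  revert f g. induction m as [| m IH]; intros f g F G.
  - split; [| exact I]. intros q. apply ccontinuous_lin; [apply F | apply G].
  - pose proof (class_C_partials _ _ F) as Pf. pose proof (class_C_partials _ _ G) as Pg.
    destruct F as (Fc & _ & Fx & Fy & Fz), G as (Gc & _ & Gx & Gy & Gz).
    refine (class_C_intro _ _ _ _ _ _ (has_partials_lin c d _ _ _ _ _ _ _ _ Pf Pg) _ _ _);
      try (apply IH; assumption).
    intros q. apply ccontinuous_lin; auto.
Qed.

Lemma smooth_partials (f : R3 -> C) :
  smooth f -> has_partials f (dx f) (dy f) (dz f).
Proof. intros H. exact (class_C_partials 0 f (H 1%nat)). Qed.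

Lemma smooth_continuous (f : R3 -> C) (q : R3) : smooth f -> continuous f q.
Proof. intros H. exact (class_C_continuous 0 f (H 0%nat) q). Qed.

Lemma smooth_dx (f : R3 -> C) : smooth f -> smooth (dx f).
Proof. intros H m. apply (H (S m)). Qed.

Lemma smooth_dy (f : R3 -> C) : smooth f -> smooth (dy f).
Proof. intros H m. apply (H (S m)). Qed.

Lemma smooth_dz (f : R3 -> C) : smooth f -> smooth (dz f).
Proof. intros H m. apply (H (S m)). Qed.

Lemma smooth_dzeta (f : R3 -> C) : smooth f -> smooth (dzeta f).
Proof.
  intros H m.
  replace (dzeta f) with
    (fun q => RtoC (/ sqrt 2) * dx f q + (- RtoC (/ sqrt 2) * Ci) * dy f q)%C.
  - apply class_C_lin; apply (H (S m)).
  - apply functional_extensionality; intros q; unfold dzeta; ring.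
Qed.

Lemma smooth_dzetabar (f : R3 -> C) : smooth f -> smooth (dzetabar f).
Proof.
  intros H m.
  replace (dzetabar f) with
    (fun q => RtoC (/ sqrt 2) * dx f q + (RtoC (/ sqrt 2) * Ci) * dy f q)%C.
  - apply class_C_lin; apply (H (S m)).
  - apply functional_extensionality; intros q; unfold dzetabar; ring.
Qed.

Lemma Nat_iter_ind {A : Type} (P : A -> Prop) (g : A -> A) (m : nat) (a : A) :
  (forall b, P b -> P (g b)) -> P a -> P (Nat.iter m g a).
Proof. intros Hg Ha. induction m; simpl; auto. Qed.

Lemma smooth_iter (a b c : nat) (f : R3 -> C) :
  smooth f -> smooth (Nat.iter b dzetabar (Nat.iter a dzeta (Nat.iter c dz f))).
Proof.
  intros H.
  apply Nat_iter_ind; [exact smooth_dzetabar |].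
  apply Nat_iter_ind; [exact smooth_dzeta |].
  apply Nat_iter_ind; [exact smooth_dz | exact H].
Qed.

Lemma smooth_zeta_deriv (i n p : nat) (f : R3 -> C) :
  smooth f -> smooth (zeta_deriv i n p f).
Proof. apply smooth_iter. Qed.

(** * Averages over rotations *)

(** Compactness of [[a, b]] turns joint continuity at the points [(q, t)] into one radius around [q]
    that serves all [t], so the integrands are uniformly close. The parameter space is general
    because it will be R^3. *)
Lemma continuous_RInt_param {U : UniformSpace} (H : U -> R -> R) (a b : R) (q : U) :
  a <= b ->
  (forall (u : U) t, continuous (fun v : U * R => H (fst v) (snd v)) (u, t)) ->
  continuous (fun u => RInt (H u) a b) q.
Proof.
  intros Hab Hc.
  assert (Hi : forall u, ex_RInt (H u) a b).
  { intros u. apply (ex_RInt_continuous (V := R_CompleteNormedModule)). intros t _.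
    apply (continuous_comp_2 (fun _ => u) (fun s => s) H t);
      [apply continuous_const | apply continuous_id | apply Hc]. }
  apply (proj2 (filterlim_locally (F := locally q) _ _)). intros eps.
  (* The [+ 1] keeps the denominator positive when [a = b]; the final bound [(b - a) * e] stays
     below [eps]. *)
  set (e := eps / (2 * (b - a + 1))).
  assert (He : 0 < e).
  { unfold e. apply Rdiv_lt_0_compat; [apply cond_pos | lra]. }
  assert (Hd : forall t, exists d : posreal, forall u s,
    ball q d u -> Rabs (s - t) < d -> Rabs (H u s - H q t) < e / 2).
  { intros t.
    destruct (proj1 (filterlim_locally _ _) (Hc q t) (mkposreal (e / 2) ltac:(lra)))
      as [d Hd].
    exists d. intros u s Hu Hs. exact (Hd (u, s) (conj Hu Hs)). }
  (* Choice makes the pointwise radii a gauge, the form in which [compactness_value_1d] takes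
     them. *)
  set (delta := fun t => proj1_sig (constructive_indefinite_description _ (Hd t))).
  assert (Hdelta : forall t u s, ball q (delta t) u -> Rabs (s - t) < delta t ->
    Rabs (H u s - H q t) < e / 2).
  { intros t. exact (proj2_sig (constructive_indefinite_description _ (Hd t))). }
  destruct (compactness_value_1d a b delta) as [d Hd'].
  exists d. intros u Hu.
  change (Rabs (RInt (H u) a b - RInt (H q) a b) < eps).
  rewrite <- (RInt_minus (V := R_CompleteNormedModule) (H u) (H q)) by apply Hi.
  apply Rle_lt_trans with ((b - a) * e).
  - apply abs_RInt_le_const; [exact Hab | |].
    + apply (ex_RInt_minus (V := R_NormedModule)); apply Hi.
    + intros s Hs. change (Rabs (H u s - H q s) <= e).
      (* Compactness yields its tag [t] only under a double negation. Both [H u s] and [H q s] are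
         then compared with [H q t], at a cost of [e / 2] each. *)
      apply NNPP. intros Hn. apply (Hd' s Hs). intros (t & Ht & Hst & Hdt).
      apply Hn.
      replace (H u s - H q s) with ((H u s - H q t) - (H q s - H q t)) by ring.
      eapply Rle_trans; [apply Rabs_triang |]. rewrite Rabs_Ropp.
      assert (A1 := Hdelta t u s (ball_le _ _ _ Hdt _ Hu) Hst).
      assert (A2 := Hdelta t q s (ball_center _ _) Hst). lra.
  - unfold e. apply (Rmult_lt_reg_r (2 * (b - a + 1))); [lra |].
    replace ((b - a) * (eps / (2 * (b - a + 1))) * (2 * (b - a + 1)))
      with ((b - a) * eps) by (field; lra).
    assert (0 < eps) by apply cond_pos. nra.
Qed.

Lemma is_derive_RInt_param' (H dH : R -> R -> R) (a b s : R) :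
  (forall u t, is_derive (fun v => H v t) u (dH u t)) ->
  (forall u t, continuous (fun v => H u v) t) ->
  (forall t, continuous (fun v : R * R => dH (fst v) (snd v)) (s, t)) ->
  is_derive (fun u => RInt (H u) a b) s (RInt (dH s) a b).
Proof.
  intros Hd Hc Hdc.
  assert (E : forall u t, Derive (fun v => H v t) u = dH u t)
    by (intros; apply is_derive_unique, Hd).
  rewrite (RInt_ext (dH s) (fun t => Derive (fun u => H u t) s))
    by (intros; symmetry; apply E).
  apply is_derive_RInt_param.
  - apply filter_forall. intros u t _. eexists; apply Hd.
  - intros t _. apply (continuity_2d_pt_ext dH); [intros; symmetry; apply E |].
    apply continuity_2d_pt_filterlim, Hdc.
  - apply filter_forall. intros u.
    apply (ex_RInt_continuous (V := R_CompleteNormedModule)). intros t _. apply Hc.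
Qed.

(** Two real integrals, so that the real theorems on integrals with a parameter apply; [CInt_RInt]
    identifies it with the integral in [mode_coef] for continuous integrands. *)
Definition CInt (F : R -> C) : C :=
  (RInt (fun t => fst (F t)) 0 (2 * PI), RInt (fun t => snd (F t)) 0 (2 * PI)).

Lemma two_PI_pos : 0 < 2 * PI.
Proof. generalize PI_RGT_0; lra. Qed.

Lemma CInt_RInt (F : R -> C) :
  (forall t, continuous F t) ->
  RInt (V := C_R_CompleteNormedModule) F 0 (2 * PI) = CInt F.
Proof.
  intros Hc. apply is_RInt_unique.
  apply (is_RInt_fct_extend_pair (U := R_NormedModule) (V := R_NormedModule));
    apply (RInt_correct (V := R_CompleteNormedModule));
    apply (ex_RInt_continuous (V := R_CompleteNormedModule)); intros t _;
    auto using ccontinuous_fst, ccontinuous_snd.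
Qed.

Lemma CInt_ext (F G : R -> C) : (forall t, F t = G t) -> CInt F = CInt G.
Proof. intros H. f_equal. apply functional_extensionality, H. Qed.

Lemma CInt_const (c : C) : CInt (fun _ => c) = (RtoC (2 * PI) * c)%C.
Proof.
  unfold CInt. rewrite !(RInt_const (V := R_CompleteNormedModule)).
  apply C_eq; simpl; unfold scal; simpl; unfold mult; simpl; ring.
Qed.

Lemma CInt_lin (c d : C) (F G : R -> C) :
  (forall t, continuous F t) -> (forall t, continuous G t) ->
  CInt (fun t => c * F t + d * G t)%C = (c * CInt F + d * CInt G)%C.
Proof.
  intros HF HG.
  assert (E : forall f : R -> R, (forall t, continuous f t) -> is_RInt f 0 (2 * PI) (RInt f 0 (2 * PI))).
  { intros f Hf. apply (RInt_correct (V := R_CompleteNormedModule)),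
      (ex_RInt_continuous (V := R_CompleteNormedModule)). auto. }
  (* Each component of [c * F + d * G] is a combination of four real integrands; [L] serves both
     components. *)
  assert (L : forall (x1 x2 x3 x4 : R) (f1 f2 f3 f4 : R -> R),
    (forall t, continuous f1 t) -> (forall t, continuous f2 t) ->
    (forall t, continuous f3 t) -> (forall t, continuous f4 t) ->
    RInt (fun t => x1 * f1 t + x2 * f2 t + (x3 * f3 t + x4 * f4 t)) 0 (2 * PI)
    = x1 * RInt f1 0 (2 * PI) + x2 * RInt f2 0 (2 * PI)
      + (x3 * RInt f3 0 (2 * PI) + x4 * RInt f4 0 (2 * PI))).
  { intros x1 x2 x3 x4 f1 f2 f3 f4 H1 H2 H3 H4. apply is_RInt_unique.
    apply (is_RInt_plus (V := R_NormedModule) (fun t => x1 * f1 t + x2 * f2 t)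
      (fun t => x3 * f3 t + x4 * f4 t)).
    - apply (is_RInt_plus (V := R_NormedModule) (fun t => x1 * f1 t) (fun t => x2 * f2 t));
        apply (is_RInt_scal (V := R_NormedModule)), E; assumption.
    - apply (is_RInt_plus (V := R_NormedModule) (fun t => x3 * f3 t) (fun t => x4 * f4 t));
        apply (is_RInt_scal (V := R_NormedModule)), E; assumption. }
  unfold CInt. apply C_eq; simpl.
  - transitivity (RInt (fun t => fst c * fst (F t) + - snd c * snd (F t)
      + (fst d * fst (G t) + - snd d * snd (G t))) 0 (2 * PI)).
    { apply RInt_ext. intros t _. simpl. ring. }
    rewrite L by auto using ccontinuous_fst, ccontinuous_snd. ring.
  - transitivity (RInt (fun t => fst c * snd (F t) + snd c * fst (F t)
      + (fst d * snd (G t) + snd d * fst (G t))) 0 (2 * PI)).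
    { apply RInt_ext. intros t _. simpl. ring. }
    rewrite L by auto using ccontinuous_fst, ccontinuous_snd. ring.
Qed.

Lemma continuous_CInt {U : UniformSpace} (H : U -> R -> C) (q : U) :
  (forall (u : U) t, continuous (fun v : U * R => H (fst v) (snd v)) (u, t)) ->
  continuous (fun u => CInt (H u)) q.
Proof.
  intros Hc. assert (P := two_PI_pos).
  apply ccontinuous_pair; simpl; apply continuous_RInt_param; try lra; intros u t.
  - apply (ccontinuous_fst (fun v : U * R => H (fst v) (snd v))), Hc.
  - apply (ccontinuous_snd (fun v : U * R => H (fst v) (snd v))), Hc.
Qed.

Lemma is_cderive_CInt (H dH : R -> R -> C) (s : R) :
  (forall u t, is_cderive (fun v => H v t) u (dH u t)) ->
  (forall u t, continuous (fun v => H u v) t) ->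
  (forall t, continuous (fun v : R * R => dH (fst v) (snd v)) (s, t)) ->
  is_cderive (fun u => CInt (H u)) s (CInt (dH s)).
Proof.
  intros Hd Hc Hdc. split; simpl.
  - apply (is_derive_RInt_param' (fun u t => fst (H u t)) (fun u t => fst (dH u t))).
    + intros u t. apply Hd.
    + intros u t. apply ccontinuous_fst, Hc.
    + intros t. apply (ccontinuous_fst (fun v : R * R => dH (fst v) (snd v))), Hdc.
  - apply (is_derive_RInt_param' (fun u t => snd (H u t)) (fun u t => snd (dH u t))).
    + intros u t. apply Hd.
    + intros u t. apply ccontinuous_snd, Hc.
    + intros t. apply (ccontinuous_snd (fun v : R * R => dH (fst v) (snd v))), Hdc.
Qed.

Lemma continuous_pair {U V W : UniformSpace} (f : U -> V) (g : U -> W) (q : U) :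
  continuous f q -> continuous g q -> continuous (fun u => (f u, g u)) q.
Proof.
  intros F G. apply (continuous_comp_2 f g (fun a b => (a, b)) q F G).
  apply (continuous_ext (fun u => u)); [intros [a b]; reflexivity |].
  apply continuous_id.
Qed.

Lemma continuous_fst_comp {U V W : UniformSpace} (f : U -> V * W) (q : U) :
  continuous f q -> continuous (fun u => fst (f u)) q.
Proof.
  intros H. apply (continuous_comp f fst q H). destruct (f q); apply continuous_fst.
Qed.

Lemma continuous_snd_comp {U V W : UniformSpace} (f : U -> V * W) (q : U) :
  continuous f q -> continuous (fun u => snd (f u)) q.
Proof.
  intros H. apply (continuous_comp f snd q H). destruct (f q); apply continuous_snd.
Qed.

Lemma continuous_Rplus {U : UniformSpace} (f g : U -> R) (q : U) :
  continuous f q -> continuous g q -> continuous (fun u => f u + g u) q.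
Proof. exact (continuous_plus (V := R_NormedModule) f g q). Qed.

Lemma continuous_Rminus {U : UniformSpace} (f g : U -> R) (q : U) :
  continuous f q -> continuous g q -> continuous (fun u => f u - g u) q.
Proof. exact (continuous_minus (V := R_NormedModule) f g q). Qed.

Lemma continuous_Rmult {U : UniformSpace} (f g : U -> R) (q : U) :
  continuous f q -> continuous g q -> continuous (fun u => f u * g u) q.
Proof. exact (continuous_mult (K := R_AbsRing) f g q). Qed.

Lemma continuous_Ropp {U : UniformSpace} (f : U -> R) (q : U) :
  continuous f q -> continuous (fun u => - f u) q.
Proof. exact (continuous_opp (V := R_NormedModule) f q). Qed.

Lemma continuous_cos_comp {U : UniformSpace} (f : U -> R) (q : U) :
  continuous f q -> continuous (fun u => cos (f u)) q.
Proof. intros H. apply (continuous_comp f cos q H), continuous_cos. Qed.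

Lemma continuous_sin_comp {U : UniformSpace} (f : U -> R) (q : U) :
  continuous f q -> continuous (fun u => sin (f u)) q.
Proof. intros H. apply (continuous_comp f sin q H), continuous_sin. Qed.

Ltac solve_continuous :=
  repeat (try assumption;
    lazymatch goal with
    | |- continuous (fun _ => ?c) _ => apply continuous_const
    | |- continuous (fun u => u) _ => apply continuous_id
    | |- continuous (fun u => pair (@?f u) (@?g u)) _ => apply (continuous_pair f g)
    | |- continuous (fun u => Rplus (@?f u) (@?g u)) _ => apply (continuous_Rplus f g)
    | |- continuous (fun u => Rminus (@?f u) (@?g u)) _ => apply (continuous_Rminus f g)
    | |- continuous (fun u => Rmult (@?f u) (@?g u)) _ => apply (continuous_Rmult f g)
    | |- continuous (fun u => Ropp (@?f u)) _ => apply (continuous_Ropp f)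
    | |- continuous (fun u => cos (@?f u)) _ => apply (continuous_cos_comp f)
    | |- continuous (fun u => sin (@?f u)) _ => apply (continuous_sin_comp f)
    | |- continuous (fun u => fst (@?f u)) _ => apply (continuous_fst_comp f)
    | |- continuous (fun u => snd (@?f u)) _ => apply (continuous_snd_comp f)
    end).

(** Both partials together with continuity of [fx] give differentiability in the plane with [z]
    frozen; the real two-variable chain rule then applies to each component. *)
Lemma is_cderive_chain (f fx fy fz : R3 -> C) (u v : R -> R) (z s u' v' : R) :
  has_partials f fx fy fz -> (forall q : R3, continuous fx q) ->
  is_derive u s u' -> is_derive v s v' ->
  is_cderive (fun t => f (u t, v t, z)) s
    (RtoC u' * fx (u s, v s, z) + RtoC v' * fy (u s, v s, z))%C.
Proof.
  intros Hp Hc Hu Hv.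
  assert (K : forall g gx gy : R -> R -> R,
    (forall x y, is_derive (fun t => g t y) x (gx x y)) ->
    (forall x y, is_derive (fun t => g x t) y (gy x y)) ->
    (forall x y, continuous (fun w : R * R => gx (fst w) (snd w)) (x, y)) ->
    is_derive (fun t => g (u t) (v t)) s
      (gx (u s) (v s) * u' + gy (u s) (v s) * v')).
  { intros g gx gy Hx Hy Hxc. apply is_derive_Reals.
    apply derivable_pt_lim_comp_2d; try (apply is_derive_Reals; assumption).
    apply filterdiff_differentiable_pt_lim.
    apply (is_derive_filterdiff g (u s) (v s) gx (gy (u s) (v s))).
    - apply filter_forall. intros [a b]. apply Hx.
    - apply Hy.
    - apply Hxc. }
  split; simpl.
  - replace (_ + _) with (fst (fx (u s, v s, z)) * u' + fst (fy (u s, v s, z)) * v') by ring.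
    apply (K (fun x y => fst (f (x, y, z))) (fun x y => fst (fx (x, y, z)))
      (fun x y => fst (fy (x, y, z)))); intros x y; try apply (Hp (x, y, z)).
    apply (ccontinuous_fst (fun w : R * R => fx (fst w, snd w, z))).
    apply (continuous_comp (fun w : R * R => (fst w, snd w, z)) fx); [| apply Hc].
    solve_continuous.
  - replace (_ + _) with (snd (fx (u s, v s, z)) * u' + snd (fy (u s, v s, z)) * v') by ring.
    apply (K (fun x y => snd (f (x, y, z))) (fun x y => snd (fx (x, y, z)))
      (fun x y => snd (fy (x, y, z)))); intros x y; try apply (Hp (x, y, z)).
    apply (ccontinuous_snd (fun w : R * R => fx (fst w, snd w, z))).
    apply (continuous_comp (fun w : R * R => (fst w, snd w, z)) fx); [| apply Hc].
    solve_continuous.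
Qed.

Definition rot (t : R) : R3 -> R3 :=
  fun '(x, y, z) => (x * cos t - y * sin t, x * sin t + y * cos t, z).

(** The weight is arbitrary because differentiating [f (rot t q)] in [q] produces factors [cos t]
    and [sin t]. Absorbed into the weight, they keep the family of averages closed under partial
    derivatives, which the projections on modes alone would not be. *)
Definition avg (w : R -> C) (f : R3 -> C) : R3 -> C :=
  fun q => CInt (fun t => w t * f (rot t q))%C.

Lemma continuous_rot (q : R3) (t : R) :
  continuous (fun v : R3 * R => rot (snd v) (fst v)) (q, t).
Proof.
  apply (continuous_ext (fun v : R3 * R =>
    (fst (fst (fst v)) * cos (snd v) - snd (fst (fst v)) * sin (snd v),
     fst (fst (fst v)) * sin (snd v) + snd (fst (fst v)) * cos (snd v),
     snd (fst v)))).
  { intros [[[x y] z] s]; reflexivity. }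
  unfold R3 in *. solve_continuous.
Qed.

Lemma continuous_rot_comp {U : UniformSpace} (f : R3 -> C) (p : U -> R3) (s : U -> R) (q : U) :
  (forall q : R3, continuous f q) -> continuous p q -> continuous s q ->
  continuous (fun u => f (rot (s u) (p u))) q.
Proof.
  intros Hf Hp Hs. apply (continuous_comp (fun u => rot (s u) (p u)) f); [| apply Hf].
  exact (continuous_comp_2 p s (fun p s => rot s p) q Hp Hs (continuous_rot _ _)).
Qed.

Lemma avg_integrand_continuous (w : R -> C) (f : R3 -> C) (q : R3) (t : R) :
  (forall t, continuous w t) -> (forall q : R3, continuous f q) ->
  continuous (fun t => w t * f (rot t q))%C t.
Proof.
  intros Hw Hf. apply ccontinuous_mult; [apply Hw |].
  apply (continuous_rot_comp f (fun _ => q) (fun s => s)); auto using continuous_const, continuous_id.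
Qed.

Lemma avg_continuous (w : R -> C) (f : R3 -> C) (q : R3) :
  (forall t, continuous w t) -> (forall q : R3, continuous f q) ->
  continuous (avg w f) q.
Proof.
  intros Hw Hf. apply (continuous_CInt (fun (q : R3) t => w t * f (rot t q))%C).
  intros u t. apply ccontinuous_mult.
  - apply (continuous_comp snd w); [apply continuous_snd | apply Hw].
  - apply (continuous_rot_comp f (fun v : R3 * R => fst v) (fun v => snd v)); [exact Hf | |];
      solve_continuous.
Qed.

Lemma avg_lin_l (c d : C) (w1 w2 : R -> C) (f : R3 -> C) (q : R3) :
  (forall t, continuous w1 t) -> (forall t, continuous w2 t) ->
  (forall q : R3, continuous f q) ->
  (c * avg w1 f q + d * avg w2 f q)%C = avg (fun t => c * w1 t + d * w2 t)%C f q.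
Proof.
  intros H1 H2 Hf. unfold avg. rewrite <- CInt_lin.
  - apply CInt_ext. intros t. ring.
  - intros t. apply avg_integrand_continuous; assumption.
  - intros t. apply avg_integrand_continuous; assumption.
Qed.

Lemma avg_lin_r (c d : C) (w : R -> C) (f g : R3 -> C) (q : R3) :
  (forall t, continuous w t) ->
  (forall q : R3, continuous f q) -> (forall q : R3, continuous g q) ->
  (c * avg w f q + d * avg w g q)%C = avg w (fun q => c * f q + d * g q)%C q.
Proof.
  intros Hw Hf Hg. unfold avg. rewrite <- CInt_lin.
  - apply CInt_ext. intros t. ring.
  - intros t. apply avg_integrand_continuous; assumption.
  - intros t. apply avg_integrand_continuous; assumption.
Qed.

Definition wcos (w : R -> C) (t : R) : C := (RtoC (cos t) * w t)%C.
Definition wsin (w : R -> C) (t : R) : C := (RtoC (sin t) * w t)%C.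

Lemma wcos_continuous (w : R -> C) :
  (forall t, continuous w t) -> forall t, continuous (wcos w) t.
Proof.
  intros Hw t. apply ccontinuous_mult; [| apply Hw].
  apply ccontinuous_RtoC, continuous_cos.
Qed.

Lemma wsin_continuous (w : R -> C) :
  (forall t, continuous w t) -> forall t, continuous (wsin w) t.
Proof.
  intros Hw t. apply ccontinuous_mult; [| apply Hw].
  apply ccontinuous_RtoC, continuous_sin.
Qed.

(** Chain rule under the integral: the entries of the rotation matrix move into the weights. The
    coefficients [RtoC 1] and [RtoC (- 1)] give the shape [c * f + d * g] of the linearity
    lemmas. *)
Lemma avg_partials (w : R -> C) (f fx fy fz : R3 -> C) :
  (forall t, continuous w t) -> (forall q : R3, continuous f q) ->
  has_partials f fx fy fz -> (forall q : R3, continuous fx q) ->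
  (forall q : R3, continuous fy q) -> (forall q : R3, continuous fz q) ->
  has_partials (avg w f)
    (fun q => RtoC 1 * avg (wcos w) fx q + RtoC 1 * avg (wsin w) fy q)%C
    (fun q => RtoC (- 1) * avg (wsin w) fx q + RtoC 1 * avg (wcos w) fy q)%C
    (avg w fz).
Proof.
  intros Hw Hf Hp Hx Hy Hz [[x y] z].
  assert (Hwc := wcos_continuous w Hw). assert (Hws := wsin_continuous w Hw).
  (* Joint continuity of a weighted integrand along a path [p]; the paths used are the three
     coordinate lines. *)
  assert (Hwj : forall (g : R3 -> C) (v : R -> C) (p : R -> R3) (s t : R),
    (forall t, continuous v t) -> (forall q : R3, continuous g q) ->
    continuous p s ->
    continuous (fun u : R * R => v (snd u) * g (rot (snd u) (p (fst u))))%C (s, t)).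
  { intros g v p s t Hv Hg Hpp. apply ccontinuous_mult.
    - apply (continuous_comp snd v); [apply continuous_snd | apply Hv].
    - apply (continuous_rot_comp g (fun u : R * R => p (fst u)) (fun u => snd u)); [exact Hg | |].
      + apply (continuous_comp fst p); [apply continuous_fst | exact Hpp].
      + solve_continuous. }
  split; [| split].
  - unfold avg; cbv beta. rewrite <- CInt_lin; try (intros t; apply avg_integrand_continuous; assumption).
    apply (is_cderive_CInt (fun x t => w t * f (rot t (x, y, z)))%C
      (fun x t => RtoC 1 * (wcos w t * fx (rot t (x, y, z)))
                  + RtoC 1 * (wsin w t * fy (rot t (x, y, z))))%C).
    + intros u t.
      replace (_ + _)%C with (w t * (RtoC (cos t) * fx (rot t (u, y, z)) + RtoC (sin t) * fy (rot t (u, y, z))))%C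
        by (unfold wcos, wsin; ring).
      apply is_cderive_cst_mult.
      apply (is_cderive_chain f fx fy fz (fun u => u * cos t - y * sin t)
        (fun u => u * sin t + y * cos t)); auto; auto_derive; auto; ring.
    + intros u t. apply avg_integrand_continuous; assumption.
    + intros t. apply ccontinuous_lin; apply (Hwj _ _ (fun s => (s, y, z))); auto;
        unfold R3; solve_continuous.
  - unfold avg; cbv beta. rewrite <- CInt_lin; try (intros t; apply avg_integrand_continuous; assumption).
    apply (is_cderive_CInt (fun y t => w t * f (rot t (x, y, z)))%C
      (fun y t => RtoC (- 1) * (wsin w t * fx (rot t (x, y, z)))
                  + RtoC 1 * (wcos w t * fy (rot t (x, y, z))))%C).
    + intros u t.
      replace (_ + _)%C with (w t * (RtoC (- sin t) * fx (rot t (x, u, z)) + RtoC (cos t) * fy (rot t (x, u, z))))%C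
        by (unfold wcos, wsin; rewrite !RtoC_opp; ring).
      apply is_cderive_cst_mult.
      apply (is_cderive_chain f fx fy fz (fun u => x * cos t - u * sin t)
        (fun u => x * sin t + u * cos t)); auto; auto_derive; auto; ring.
    + intros u t. apply avg_integrand_continuous; assumption.
    + intros t. apply ccontinuous_lin; apply (Hwj _ _ (fun s => (x, s, z))); auto;
        unfold R3; solve_continuous.
  - unfold avg. apply (is_cderive_CInt (fun z t => w t * f (rot t (x, y, z)))%C
      (fun z t => w t * fz (rot t (x, y, z)))%C).
    + intros u t. apply is_cderive_cst_mult. apply (Hp (rot t (x, y, u))).
    + intros u t. apply avg_integrand_continuous; assumption.
    + intros t. apply (Hwj _ _ (fun s => (x, y, s))); auto;
        unfold R3; solve_continuous.
Qed.

(** The induction runs over all weights at once, since each derivative replaces [w] by [wcos w] or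
    [wsin w]. *)
Lemma avg_class_C (m : nat) (w : R -> C) (f : R3 -> C) :
  (forall t, continuous w t) -> class_C m f -> class_C m (avg w f).
Proof.
  revert w f. induction m as [| m IH]; intros w f Hw Hf.
  - split; [| exact I]. intros q. apply avg_continuous; [exact Hw | apply Hf].
  - assert (Hp := class_C_partials _ _ Hf). destruct Hf as (Hc & _ & Hx & Hy & Hz).
    assert (Hwc := wcos_continuous w Hw). assert (Hws := wsin_continuous w Hw).
    refine (class_C_intro _ _ _ _ _ _ (avg_partials w f _ _ _ Hw Hc Hp _ _ _) _ _ _);
      try (apply (class_C_continuous m); assumption);
      try (apply class_C_lin); auto.
    intros q. apply avg_continuous; assumption.
Qed.

(** * Angular modes *)

Lemma Ci_sqr : (Ci * Ci)%C = (- RtoC 1)%C.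
Proof. apply C_eq; simpl; ring. Qed.

Lemma cis_plus (a b : R) : cis (a + b) = (cis a * cis b)%C.
Proof. unfold cis. rewrite cos_plus, sin_plus. apply C_eq; simpl; ring. Qed.

Lemma cis_0 : cis 0 = RtoC 1.
Proof. unfold cis. rewrite cos_0, sin_0. reflexivity. Qed.

Lemma cis_opp_mult (a : R) : (cis (- a) * cis a)%C = RtoC 1.
Proof. rewrite <- cis_plus, Rplus_opp_l. apply cis_0. Qed.

(** For an integer [j], [cis (IZR j * a)] is the j-th power of [cis a]. Hence in a mode function
    [polar_angle] may be exchanged for any other angle of the same point. *)
Lemma cis_Zmult_eq (a b : R) : cis a = cis b -> forall j : Z, cis (IZR j * a) = cis (IZR j * b).
Proof.
  intros E.
  assert (En : cis (- a) = cis (- b)).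
  { transitivity (cis (- a) * (cis (- b) * cis b))%C; [rewrite cis_opp_mult; ring |].
    rewrite <- E.
    transitivity ((cis (- a) * cis a) * cis (- b))%C; [ring |].
    rewrite cis_opp_mult; ring. }
  apply Z.peano_ind.
  - rewrite !Rmult_0_l. reflexivity.
  - intros j IH. rewrite succ_IZR, !Rmult_plus_distr_r, !Rmult_1_l, !cis_plus, IH, E.
    reflexivity.
  - intros j IH. unfold Z.pred. rewrite plus_IZR, !Rmult_plus_distr_r, !cis_plus, IH.
    replace (-1 * a) with (- a) by ring. replace (-1 * b) with (- b) by ring.
    rewrite En. reflexivity.
Qed.

Lemma cis_2PI_Z (j : Z) : cis (IZR j * (2 * PI)) = RtoC 1.
Proof.
  rewrite (cis_Zmult_eq (2 * PI) 0).
  - rewrite Rmult_0_r. apply cis_0.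
  - unfold cis. rewrite cos_2PI, sin_2PI, cos_0, sin_0. reflexivity.
Qed.

Lemma continuous_cis {U : UniformSpace} (f : U -> R) (q : U) :
  continuous f q -> continuous (fun u => cis (f u)) q.
Proof.
  intros H. apply ccontinuous_pair; simpl; solve_continuous.
Qed.

Lemma radius_sqr (x y : R) : sqrt (x ^ 2 + y ^ 2) * sqrt (x ^ 2 + y ^ 2) = x ^ 2 + y ^ 2.
Proof. apply sqrt_sqrt. nra. Qed.

Lemma radius_zero (x y : R) : sqrt (x ^ 2 + y ^ 2) = 0 -> x = 0 /\ y = 0.
Proof. intros E. assert (H := radius_sqr x y). rewrite E in H. split; nra. Qed.

Lemma radius_pos (x y : R) : x <> 0 \/ y <> 0 -> 0 < sqrt (x ^ 2 + y ^ 2).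
Proof.
  intros H. destruct (Rle_lt_or_eq_dec 0 _ (sqrt_pos (x ^ 2 + y ^ 2))) as [Hr | E];
    [exact Hr |].
  destruct (radius_zero x y (eq_sym E)). tauto.
Qed.

Lemma cos_ratio_bound (x y r : R) : 0 < r -> r * r = x ^ 2 + y ^ 2 -> -1 <= x / r <= 1.
Proof.
  intros Hr Hs. split.
  - apply (Rmult_le_reg_r r); [exact Hr |]. unfold Rdiv.
    rewrite Rmult_assoc, Rinv_l by lra. nra.
  - apply (Rmult_le_reg_r r); [exact Hr |]. unfold Rdiv.
    rewrite Rmult_assoc, Rinv_l by lra. nra.
Qed.

(** Holds at the origin too, where the radius factor vanishes whatever the angle is; this is why
    [rot_polar] needs no case distinction. *)
Lemma polar_radius_cos (x y : R) :
  sqrt (x ^ 2 + y ^ 2) * cos (polar_angle x y) = x.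
Proof.
  assert (Hs := radius_sqr x y). assert (Hz := radius_zero x y).
  unfold polar_angle.
  destruct (Rle_lt_or_eq_dec 0 _ (sqrt_pos (x ^ 2 + y ^ 2))) as [Hr | E].
  - set (r := sqrt (x ^ 2 + y ^ 2)) in *.
    assert (E : cos (acos (x / r)) = x / r) by (apply cos_acos, (cos_ratio_bound x y); assumption).
    destruct (Rle_dec 0 y); rewrite ?cos_neg, E; field; lra.
  - destruct (Hz (eq_sym E)) as [-> _]. rewrite <- E at 1. ring.
Qed.

Lemma polar_radius_sin (x y : R) :
  sqrt (x ^ 2 + y ^ 2) * sin (polar_angle x y) = y.
Proof.
  assert (Hs := radius_sqr x y). assert (Hz := radius_zero x y).
  unfold polar_angle.
  destruct (Rle_lt_or_eq_dec 0 _ (sqrt_pos (x ^ 2 + y ^ 2))) as [Hr | E].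
  - set (r := sqrt (x ^ 2 + y ^ 2)) in *.
    (* The sine of an arc cosine is never negative, hence the absolute value; the test on [y] in
       [polar_angle] restores the sign. *)
    assert (E : sin (acos (x / r)) = Rabs y / r).
    { rewrite sin_acos by (apply (cos_ratio_bound x y); assumption).
      apply sqrt_lem_1.
      - assert (0 <= 1 - (x / r)²); [| lra].
        destruct (cos_ratio_bound x y r Hr Hs). unfold Rsqr. nra.
      - apply Rmult_le_pos; [apply Rabs_pos | left; apply Rinv_0_lt_compat, Hr].
      - replace (Rabs y / r * (Rabs y / r)) with (Rabs y * Rabs y / (r * r)) by (field; lra).
        rewrite <- Rabs_mult, Rabs_pos_eq by nra.
        unfold Rsqr. replace (y * y) with (r * r - x ^ 2) by lra. field; lra. }
    destruct (Rle_dec 0 y); rewrite ?sin_neg, E.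
    + rewrite Rabs_pos_eq by assumption. field; lra.
    + rewrite Rabs_left by lra. field; lra.
  - destruct (Hz (eq_sym E)) as [_ ->]. rewrite <- E at 1. ring.
Qed.

(** * Rotations, equivariant functions and the projection on a mode *)

Lemma rot_rot (s t : R) (q : R3) : rot s (rot t q) = rot (s + t) q.
Proof.
  destruct q as [[x y] z]. unfold rot. rewrite cos_plus, sin_plus.
  f_equal; f_equal; ring.
Qed.

Lemma rot_axis (t z : R) : rot t (0, 0, z) = (0, 0, z).
Proof. unfold rot. f_equal; f_equal; ring. Qed.

Lemma rot_ray (t r z : R) : rot t (r, 0, z) = (r * cos t, r * sin t, z).
Proof. unfold rot. f_equal; f_equal; ring. Qed.

Lemma rot_polar (x y z : R) :
  (x, y, z) = rot (polar_angle x y) (sqrt (x ^ 2 + y ^ 2), 0, z).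
Proof. rewrite rot_ray, polar_radius_cos, polar_radius_sin. reflexivity. Qed.

(** Equivalent to [is_mode] but free of angles and coefficients, hence checked directly on averages.
    The vanishing on the axis becomes a consequence, [equivariant_axis]. *)
Definition equivariant (j : Z) (f : R3 -> C) : Prop :=
  forall t q, f (rot t q) = (cis (IZR j * t) * f q)%C.

Definition trace (f : R3 -> C) : R * R -> C := fun '(r, z) => f (r, 0, z).

Lemma is_mode_equivariant (j : Z) (f : R3 -> C) : is_mode j f -> equivariant j f.
Proof.
  intros (phi & Hphi & _) t [[x y] z].
  rewrite (rot_polar x y z), rot_rot, !rot_ray.
  rewrite !Hphi by apply sqrt_pos.
  rewrite Rmult_plus_distr_l, cis_plus. ring.
Qed.

Lemma equivariant_axis (j : Z) (f : R3 -> C) (z : R) :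
  equivariant j f -> j <> 0%Z -> f (0, 0, z) = RtoC 0.
Proof.
  (* The rotation by [PI / j] fixes the axis and multiplies the value by [cis PI = -1]. *)
  intros H Hj. assert (E := H (PI / IZR j) (0, 0, z)). rewrite rot_axis in E.
  replace (IZR j * (PI / IZR j)) with PI in E by (field; apply not_0_IZR; exact Hj).
  unfold cis in E. rewrite cos_PI, sin_PI in E.
  destruct (f (0, 0, z)) as [a b]. injection E as E1 E2.
  apply C_eq; simpl; lra.
Qed.

Lemma equivariant_is_mode (j : Z) (f : R3 -> C) : equivariant j f -> is_mode j f.
Proof.
  intros H. exists (trace f). split.
  - intros r t z _. rewrite <- rot_ray. apply H.
  - intros Hj z. exact (equivariant_axis j f z H Hj).
Qed.

Lemma mode_function_ext (j : Z) (phi psi : R * R -> C) :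
  (forall r z, 0 <= r -> phi (r, z) = psi (r, z)) -> mode_function j phi = mode_function j psi.
Proof.
  intros H. apply functional_extensionality. intros [[x y] z]. simpl.
  rewrite H by apply sqrt_pos. reflexivity.
Qed.

Lemma equivariant_mode_function (j : Z) (f : R3 -> C) :
  equivariant j f -> mode_function j (trace f) = f.
Proof.
  intros H. apply functional_extensionality. intros [[x y] z].
  rewrite (rot_polar x y z) at 2. rewrite H. reflexivity.
Qed.

Definition weight (j : Z) (t : R) : C := (RtoC (/ (2 * PI)) * cis (- (IZR j * t)))%C.

Definition mean (j : Z) (f : R3 -> C) : R3 -> C := avg (weight j) f.

Lemma weight_continuous (j : Z) (t : R) : continuous (weight j) t.
Proof.
  apply ccontinuous_mult; [apply continuous_const |].
  apply continuous_cis. solve_continuous.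
Qed.

(** The factor [cis (j t)] of [f (rot t q)] cancels the one in the weight, so the integrand is the
    constant [f q / (2 PI)]. *)
Lemma equivariant_mean (j : Z) (f : R3 -> C) : equivariant j f -> mean j f = f.
Proof.
  intros H. apply functional_extensionality. intros q.
  unfold mean, avg, weight.
  transitivity (CInt (fun _ => RtoC (/ (2 * PI)) * f q)%C).
  - apply CInt_ext. intros t. rewrite H.
    transitivity (RtoC (/ (2 * PI)) * (cis (- (IZR j * t)) * cis (IZR j * t)) * f q)%C;
      [ring |]. rewrite cis_opp_mult. ring.
  - rewrite CInt_const. assert (P := two_PI_pos).
    rewrite RtoC_inv by lra. field. intros E. injection E. lra.
Qed.

(** The integral over [[a, p + a]] differs from that over [[0, p]] by the pieces from [a] to [0] and
    from [p] to [p + a], which cancel by periodicity. *)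
Lemma RInt_periodic_shift (h : R -> R) (a p : R) :
  (forall t, continuous h t) -> (forall t, h (t + p) = h t) ->
  RInt (fun t => h (t + a)) 0 p = RInt h 0 p.
Proof.
  intros Hc Hp.
  assert (Hi : forall u v, ex_RInt h u v).
  { intros u v. apply (ex_RInt_continuous (V := R_CompleteNormedModule)). auto. }
  assert (Hs : forall c u v, RInt (fun t => h (t + c)) u v = RInt h (u + c) (v + c)).
  { intros c u v.
    (* The linear change of variables wants the integrand in the form [u * h (u * t + c)]; here
       [u = 1]. *)
    rewrite <- (RInt_ext (fun t => scal 1 (h (1 * t + c)))).
    - rewrite (RInt_comp_lin (V := R_CompleteNormedModule)) by apply Hi.
      rewrite !Rmult_1_l. reflexivity.
    - intros t _. change (1 * h (1 * t + c) = h (t + c)).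
      rewrite !Rmult_1_l. reflexivity. }
  rewrite Hs, Rplus_0_l.
  rewrite <- (RInt_Chasles (V := R_CompleteNormedModule) h a 0 (p + a)) by apply Hi.
  rewrite <- (RInt_Chasles (V := R_CompleteNormedModule) h 0 p (p + a)) by apply Hi.
  replace (RInt h p (p + a)) with (RInt h 0 a).
  - rewrite <- (opp_RInt_swap (V := R_CompleteNormedModule) h 0 a) by apply Hi.
    unfold plus, opp; simpl. ring.
  - rewrite <- (RInt_ext (fun t => h (t + p)) h 0 a) by auto.
    rewrite Hs. f_equal; ring.
Qed.

(** Rotating the argument by [a] shifts the integration variable. The weight pays the factor
    [cis (j a)] for the shift, and periodicity removes the shift of the interval. *)
Lemma mean_equivariant (j : Z) (f : R3 -> C) :
  (forall q : R3, continuous f q) -> equivariant j (mean j f).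
Proof.
  intros Hf a q. unfold mean, avg.
  set (h := fun t => (weight j t * f (rot t q))%C).
  assert (Hc : forall t, continuous h t).
  { intros t. apply avg_integrand_continuous; [apply weight_continuous | exact Hf]. }
  assert (Hp : forall t, h (t + 2 * PI) = h t).
  { intros t. unfold h, weight. f_equal; [f_equal |].
    - replace (- (IZR j * (t + 2 * PI))) with (- (IZR j * t) + IZR (- j) * (2 * PI))
        by (rewrite opp_IZR; ring).
      rewrite cis_plus, cis_2PI_Z. ring.
    - f_equal. destruct q as [[x y] z]. unfold rot.
      rewrite cos_plus, sin_plus, cos_2PI, sin_2PI. f_equal; f_equal; ring. }
  (* The zero summand gives the integrand the two-term shape of [CInt_lin]. *)
  transitivity (CInt (fun t => cis (IZR j * a) * h (t + a)%R + RtoC 0 * h (t + a)%R)%C).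
  - apply CInt_ext. intros t. unfold h, weight. rewrite rot_rot.
    replace (- (IZR j * t)) with (IZR j * a + - (IZR j * (t + a))) by ring.
    rewrite cis_plus. ring.
  - rewrite CInt_lin.
    + replace (CInt (fun t => h (t + a))) with (CInt h); [ring |].
      unfold CInt. apply C_eq; simpl; symmetry.
      * apply (RInt_periodic_shift (fun t => fst (h t))).
        -- intros t. apply ccontinuous_fst, Hc.
        -- intros t. rewrite Hp. reflexivity.
      * apply (RInt_periodic_shift (fun t => snd (h t))).
        -- intros t. apply ccontinuous_snd, Hc.
        -- intros t. rewrite Hp. reflexivity.
    + intros t. apply (continuous_comp (fun t => t + a) h); [solve_continuous | apply Hc].
    + intros t. apply (continuous_comp (fun t => t + a) h); [solve_continuous | apply Hc].
Qed.

(** The average is equivariant, hence determined by its values at [y = 0], where by [rot_ray] it is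
    the Fourier integral of [mode_coef]. From here on [polar_angle] is out of the way in
    [mode_part]. *)
Lemma mode_part_mean (j : Z) (f : R3 -> C) :
  (forall q : R3, continuous f q) -> mode_part j f = mean j f.
Proof.
  intros Hf. rewrite <- (equivariant_mode_function j (mean j f)) by (apply mean_equivariant, Hf).
  apply mode_function_ext. intros r z _. unfold trace, mean, avg, mode_coef.
  assert (Hc : forall t, continuous
    (fun t => (f (r * cos t, r * sin t, z)%R * cis (- (IZR j * t)))%C) t).
  { intros t. apply ccontinuous_mult.
    - apply (continuous_comp (fun t => (r * cos t, r * sin t, z)) f); [solve_continuous | apply Hf].
    - apply continuous_cis. solve_continuous. }
  rewrite CInt_RInt by exact Hc.
  transitivity (RtoC (/ (2 * PI)) * CInt (fun t => f (r * cos t, r * sin t, z)%R * cis (- (IZR j * t)))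
     + RtoC 0 * CInt (fun _ => RtoC 0))%C; [ring |].
  rewrite <- CInt_lin by (exact Hc || (intros t; apply continuous_const)).
  apply CInt_ext. intros t. rewrite rot_ray. unfold weight. ring.
Qed.

Lemma mean_partials (j : Z) (f : R3 -> C) (q : R3) :
  smooth f ->
  dx (mean j f) q = (RtoC 1 * avg (wcos (weight j)) (dx f) q
                     + RtoC 1 * avg (wsin (weight j)) (dy f) q)%C /\
  dy (mean j f) q = (RtoC (- 1) * avg (wsin (weight j)) (dx f) q
                     + RtoC 1 * avg (wcos (weight j)) (dy f) q)%C /\
  dz (mean j f) q = mean j (dz f) q.
Proof.
  intros Hf. apply has_partials_at_unique.
  apply (avg_partials (weight j) f (dx f) (dy f) (dz f) (weight_continuous j)).
  - intros u; apply smooth_continuous, Hf.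
  - apply smooth_partials, Hf.
  - intros u; apply smooth_continuous, smooth_dx, Hf.
  - intros u; apply smooth_continuous, smooth_dy, Hf.
  - intros u; apply smooth_continuous, smooth_dz, Hf.
Qed.

Lemma avg_ext_l (w v : R -> C) (f : R3 -> C) (q : R3) :
  (forall t, w t = v t) -> avg w f q = avg v f q.
Proof. intros H. apply CInt_ext. intros t. rewrite H. reflexivity. Qed.

(** The origin of the mode shift: [dzeta] applied to an average produces just this combination of
    the weights [wcos] and [wsin], and [exp (- i j t) (cos t + i sin t)] is the kernel of mode
    [j - 1]. *)
Lemma weight_pred (j : Z) (t : R) :
  weight (j - 1) t = (RtoC 1 * wcos (weight j) t + Ci * wsin (weight j) t)%C.
Proof.
  unfold weight, wcos, wsin. rewrite minus_IZR.
  replace (- ((IZR j - 1) * t)) with (- (IZR j * t) + t) by ring.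
  rewrite cis_plus. replace (cis t) with (RtoC (cos t) + Ci * RtoC (sin t))%C.
  - ring.
  - apply C_eq; simpl; ring.
Qed.

Lemma weight_succ (j : Z) (t : R) :
  weight (j + 1) t = (RtoC 1 * wcos (weight j) t + (- Ci) * wsin (weight j) t)%C.
Proof.
  unfold weight, wcos, wsin. rewrite plus_IZR.
  replace (- ((IZR j + 1) * t)) with (- (IZR j * t) + - t) by ring.
  rewrite cis_plus. replace (cis (- t)) with (RtoC (cos t) + - Ci * RtoC (sin t))%C.
  - ring.
  - unfold cis. rewrite cos_neg, sin_neg. apply C_eq; simpl; ring.
Qed.

Lemma mean_dzeta (j : Z) (f : R3 -> C) :
  smooth f -> dzeta (mean j f) = mean (j - 1) (dzeta f).
Proof.
  intros Hf. apply functional_extensionality. intros q.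
  assert (Hx := fun u => smooth_continuous _ u (smooth_dx f Hf)).
  assert (Hy := fun u => smooth_continuous _ u (smooth_dy f Hf)).
  assert (Hw := weight_continuous j).
  assert (E : forall g : R3 -> C, (forall u : R3, continuous g u) ->
    avg (weight (j - 1)) g q
    = (RtoC 1 * avg (wcos (weight j)) g q + Ci * avg (wsin (weight j)) g q)%C).
  { intros g Hg. rewrite avg_lin_l; auto using wcos_continuous, wsin_continuous.
    apply avg_ext_l, weight_pred. }
  unfold mean at 2.
  replace (dzeta f) with
    (fun q => RtoC (/ sqrt 2) * dx f q + (- RtoC (/ sqrt 2) * Ci) * dy f q)%C
    by (apply functional_extensionality; intros u; unfold dzeta; ring).
  rewrite <- avg_lin_r by (auto using weight_continuous).
  rewrite !E by assumption. unfold dzeta.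
  destruct (mean_partials j f q Hf) as (-> & -> & _).
  replace (RtoC (- 1)) with (- RtoC 1)%C by (apply C_eq; simpl; ring).
  ring [Ci_sqr].
Qed.

Lemma mean_dzetabar (j : Z) (f : R3 -> C) :
  smooth f -> dzetabar (mean j f) = mean (j + 1) (dzetabar f).
Proof.
  intros Hf. apply functional_extensionality. intros q.
  assert (Hx := fun u => smooth_continuous _ u (smooth_dx f Hf)).
  assert (Hy := fun u => smooth_continuous _ u (smooth_dy f Hf)).
  assert (Hw := weight_continuous j).
  assert (E : forall g : R3 -> C, (forall u : R3, continuous g u) ->
    avg (weight (j + 1)) g q
    = (RtoC 1 * avg (wcos (weight j)) g q + (- Ci) * avg (wsin (weight j)) g q)%C).
  { intros g Hg. rewrite avg_lin_l; auto using wcos_continuous, wsin_continuous.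
    apply avg_ext_l, weight_succ. }
  unfold mean at 2.
  replace (dzetabar f) with
    (fun q => RtoC (/ sqrt 2) * dx f q + (RtoC (/ sqrt 2) * Ci) * dy f q)%C
    by (apply functional_extensionality; intros u; unfold dzetabar; ring).
  rewrite <- avg_lin_r by (auto using weight_continuous).
  rewrite !E by assumption. unfold dzetabar.
  destruct (mean_partials j f q Hf) as (-> & -> & _).
  replace (RtoC (- 1)) with (- RtoC 1)%C by (apply C_eq; simpl; ring).
  ring [Ci_sqr].
Qed.

Lemma mean_dz (j : Z) (f : R3 -> C) : smooth f -> dz (mean j f) = mean j (dz f).
Proof.
  intros Hf. apply functional_extensionality. intros q.
  apply (mean_partials j f q Hf).
Qed.

(** [e] is the mode shift of one application of [g]: 0 for [dz], -1 for [dzeta], 1 for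
    [dzetabar]. *)
Lemma mean_iter (g : (R3 -> C) -> R3 -> C) (e : Z) (m : nat) (j : Z) (f : R3 -> C) :
  (forall h, smooth h -> smooth (g h)) ->
  (forall l h, smooth h -> g (mean l h) = mean (l + e) (g h)) ->
  smooth f -> Nat.iter m g (mean j f) = mean (j + Z.of_nat m * e) (Nat.iter m g f).
Proof.
  intros Hs Hg Hf. induction m as [| m IH].
  - simpl Nat.iter. f_equal. lia.
  - simpl Nat.iter. rewrite IH, Hg by (apply Nat_iter_ind; assumption).
    f_equal. lia.
Qed.

Lemma mean_zeta_deriv (k : Z) (i n p : nat) (f : R3 -> C) :
  (i <= n)%nat -> smooth f ->
  zeta_deriv i n p (mean (target_mode k i n) f) = mean k (zeta_deriv i n p f).
Proof.
  intros Hi Hf. unfold zeta_deriv.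
  rewrite (mean_iter dz 0 (p - n));
    [| exact smooth_dz | intros; rewrite Z.add_0_r; apply mean_dz; assumption | exact Hf].
  assert (H1 : smooth (Nat.iter (p - n) dz f))
    by (apply Nat_iter_ind; [exact smooth_dz | exact Hf]).
  rewrite (mean_iter dzeta (-1) (n - i)); [| exact smooth_dzeta | exact mean_dzeta | exact H1].
  rewrite (mean_iter dzetabar 1 i); [| exact smooth_dzetabar | exact mean_dzetabar |].
  (* The shifts add up to [- (n - i) + i], which brings [k + n - 2 i] back to [k]; as [n - i] is a
     truncated subtraction, this uses [Hi]. *)
  - f_equal. unfold target_mode. lia.
  - apply Nat_iter_ind; [exact smooth_dzeta | exact H1].
Qed.

(** * Projection of test functions and the first equivalence *)

Lemma in_cyl_rot (r0 z0 t : R) (q : R3) : in_cyl r0 z0 (rot t q) <-> in_cyl r0 z0 q.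
Proof.
  destruct q as [[x y] z]. unfold in_cyl, rot.
  replace ((x * cos t - y * sin t) ^ 2 + (x * sin t + y * cos t) ^ 2)
    with ((x ^ 2 + y ^ 2) * (Rsqr (sin t) + Rsqr (cos t))) by (unfold Rsqr; ring).
  rewrite sin2_cos2, Rmult_1_r. tauto.
Qed.

Lemma mean_mode_test_function (rad : R) (j : Z) (f : R3 -> C) :
  test_function rad f -> mode_test_function rad j (mean j f).
Proof.
  intros (Hs & r0 & z0 & Hr & Hz & Hsupp). split; [split |].
  - intros m. apply avg_class_C; [apply weight_continuous | apply Hs].
  - exists r0, z0. split; [exact Hr | split; [exact Hz |]]. intros q Hq.
    unfold mean, avg. transitivity (CInt (fun _ => RtoC 0)).
    + apply CInt_ext. intros t. rewrite Hsupp; [ring |]. rewrite in_cyl_rot. exact Hq.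
    + rewrite CInt_const. ring.
  - apply equivariant_is_mode, mean_equivariant. intros q. apply smooth_continuous, Hs.
Qed.

Lemma mode_part_zeta_deriv (k : Z) (i n p : nat) (f : R3 -> C) :
  (i <= n)%nat -> smooth f ->
  mode_part k (zeta_deriv i n p f) = zeta_deriv i n p (mode_part (target_mode k i n) f).
Proof.
  intros Hi Hf. rewrite !mode_part_mean, mean_zeta_deriv; auto.
  - intros q. apply smooth_continuous, Hf.
  - intros q. apply smooth_continuous, smooth_zeta_deriv, Hf.
Qed.

Lemma mode_part_id (j : Z) (f : R3 -> C) : smooth f -> is_mode j f -> mode_part j f = f.
Proof.
  intros Hf Hm. rewrite mode_part_mean by (intros q; apply smooth_continuous, Hf).
  apply equivariant_mean, is_mode_equivariant, Hm.
Qed.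

(** The projection commutes with the derivative. It fixes mode test functions, which gives one
    direction, and maps every test function to a mode test function, which gives the other. *)
Lemma distributional_derivative_iff (X : CompleteNormedModule C_AbsRing) (rad : R) (k : Z)
  (i n p : nat) (T : mode_distribution rad k X)
  (S : mode_distribution rad (target_mode k i n) X) :
  (i <= n)%nat ->
  (is_distributional_derivative i n p T S <->
   forall f, mode_test_function rad (target_mode k i n) f ->
     scal (sign_pow p) (T (zeta_deriv i n p f)) = S f).
Proof.
  intros Hi. split.
  - intros H f [Hf Hm]. specialize (H f Hf). unfold ext_dist in H.
    rewrite mode_part_zeta_deriv, mode_part_id in H; auto; apply Hf.
  - intros H f Hf. unfold ext_dist.
    rewrite mode_part_zeta_deriv by (auto; apply Hf).
    apply H. rewrite mode_part_mean by (intros q; apply smooth_continuous, Hf).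
    apply mean_mode_test_function, Hf.
Qed.

(** * Mode functions away from the axis *)

Lemma is_cderive_comp (g : R -> C) (h : R -> R) (t d : R) (l : C) :
  is_cderive g (h t) l -> is_derive h t d ->
  is_cderive (fun s => g (h s)) t (RtoC d * l)%C.
Proof.
  intros [G1 G2] Hh. split; simpl.
  - replace (d * fst l - 0 * snd l) with (d * fst l) by ring.
    exact (is_derive_comp (K := R_AbsRing) (V := R_NormedModule) (fun s => fst (g s)) h t _ _ G1 Hh).
  - replace (d * snd l + 0 * fst l) with (d * snd l) by ring.
    exact (is_derive_comp (K := R_AbsRing) (V := R_NormedModule) (fun s => snd (g s)) h t _ _ G2 Hh).
Qed.

(* The angle itself is discontinuous on a half-line, so only its cosine and sine are differentiated. *)
Lemma is_cderive_cis_Zmult (theta : R -> R) (s a : R) (j : Z) :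
  is_derive (fun t => cos (theta t)) s (- a * sin (theta s)) ->
  is_derive (fun t => sin (theta t)) s (a * cos (theta s)) ->
  is_cderive (fun t => cis (IZR j * theta t)) s
    (Ci * RtoC (IZR j) * RtoC a * cis (IZR j * theta s))%C.
Proof.
  intros Hc Hs.
  assert (Hp : is_cderive (fun t => cis (theta t)) s (Ci * RtoC a * cis (theta s))%C).
  { split; simpl.
    - replace (_ - _) with (- a * sin (theta s)) by ring. exact Hc.
    - replace (_ + _) with (a * cos (theta s)) by ring. exact Hs. }
  assert (Hn : is_cderive (fun t => cis (- theta t)) s (- Ci * RtoC a * cis (- theta s))%C).
  { apply (is_cderive_ext (fun t => (cos (theta t), - sin (theta t)))).
    { intros t. unfold cis. rewrite cos_neg, sin_neg. reflexivity. }
    split; simpl; rewrite ?cos_neg, ?sin_neg.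
    - replace (_ - _) with (- a * sin (theta s)) by ring. exact Hc.
    - replace (_ + _) with (- (a * cos (theta s))) by ring.
      exact (is_derive_opp (K := R_AbsRing) (V := R_NormedModule) _ _ _ Hs). }
  revert j. apply Z.peano_ind.
  - replace (_ * _)%C with (RtoC 0) by ring.
    apply (is_cderive_ext (fun _ => RtoC 1)); [| apply is_cderive_const].
    intros t. rewrite Rmult_0_l, cis_0. reflexivity.
  - intros j IH. rewrite succ_IZR.
    assert (E : forall t, cis ((IZR j + 1) * theta t) = (cis (IZR j * theta t) * cis (theta t))%C).
    { intros t. rewrite <- cis_plus. f_equal. ring. }
    apply (is_cderive_ext (fun t => cis (IZR j * theta t) * cis (theta t))%C);
      [intros t; symmetry; apply E |].
    rewrite E, RtoC_plus.
    replace (_ * _)%C with ((Ci * RtoC (IZR j) * RtoC a * cis (IZR j * theta s)) * cis (theta s)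
      + cis (IZR j * theta s) * (Ci * RtoC a * cis (theta s)))%C by ring.
    exact (is_cderive_mult _ (fun t => cis (theta t)) s _ _ IH Hp).
  - intros j IH. unfold Z.pred. rewrite plus_IZR.
    assert (E : forall t, cis ((IZR j + -1) * theta t) = (cis (IZR j * theta t) * cis (- theta t))%C).
    { intros t. rewrite <- cis_plus. f_equal. ring. }
    apply (is_cderive_ext (fun t => cis (IZR j * theta t) * cis (- theta t))%C);
      [intros t; symmetry; apply E |].
    rewrite E, RtoC_plus. replace (RtoC (-1)) with (- RtoC 1)%C by (apply C_eq; simpl; ring).
    replace (_ * _)%C with ((Ci * RtoC (IZR j) * RtoC a * cis (IZR j * theta s)) * cis (- theta s)
      + cis (IZR j * theta s) * (- Ci * RtoC a * cis (- theta s)))%C by ring.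
    exact (is_cderive_mult _ (fun t => cis (- theta t)) s _ _ IH Hn).
Qed.

(** [polar_angle] jumps across the negative x axis while its cosine and sine do not; integer powers
    of [cis] inherit the continuity of the latter. *)
Lemma continuous_cis_Zmult {U : UniformSpace} (theta : U -> R) (q : U) (j : Z) :
  continuous (fun u => cos (theta u)) q -> continuous (fun u => sin (theta u)) q ->
  continuous (fun u => cis (IZR j * theta u)) q.
Proof.
  intros Hc Hs. revert j. apply Z.peano_ind.
  - apply (continuous_ext (fun _ => cis 0)); [| apply continuous_const].
    intros u. rewrite Rmult_0_l. reflexivity.
  - intros j IH. apply (continuous_ext (fun u => cis (IZR j * theta u) * cis (theta u))%C).
    { intros u. rewrite <- cis_plus, succ_IZR. f_equal. ring. }
    apply ccontinuous_mult; [exact IH |].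
    apply ccontinuous_pair; assumption.
  - intros j IH. apply (continuous_ext (fun u => Cmult (cis (IZR j * theta u)) (cos (theta u), - sin (theta u)))).
    { intros u. replace (cos (theta u), - sin (theta u)) with (cis (- theta u))
        by (unfold cis; rewrite cos_neg, sin_neg; reflexivity).
      rewrite <- cis_plus. unfold Z.pred. rewrite plus_IZR. f_equal. ring. }
    apply ccontinuous_mult; [exact IH |].
    apply ccontinuous_pair; simpl; [exact Hc | apply continuous_Ropp, Hs].
Qed.

Lemma cos_polar_angle (x y : R) :
  x <> 0 \/ y <> 0 -> cos (polar_angle x y) = x / sqrt (x ^ 2 + y ^ 2).
Proof.
  intros H. apply radius_pos in H. rewrite <- (polar_radius_cos x y) at 2. field. lra.
Qed.

Lemma sin_polar_angle (x y : R) :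
  x <> 0 \/ y <> 0 -> sin (polar_angle x y) = y / sqrt (x ^ 2 + y ^ 2).
Proof.
  intros H. apply radius_pos in H. rewrite <- (polar_radius_sin x y) at 2. field. lra.
Qed.

Lemma locally_neq_0 (x : R) : x <> 0 -> locally x (fun t => t <> 0).
Proof.
  intros H. assert (Hx : 0 < Rabs x) by (apply Rabs_pos_lt, H).
  exists (mkposreal _ Hx). intros t Ht E. subst t.
  change (Rabs (0 - x) < Rabs x) in Ht.
  rewrite Rminus_0_l, Rabs_Ropp in Ht. lra.
Qed.

Lemma is_derive_radius_x (x y : R) :
  x <> 0 \/ y <> 0 ->
  is_derive (fun t => sqrt (t ^ 2 + y ^ 2)) x (x / sqrt (x ^ 2 + y ^ 2)).
Proof.
  intros H. assert (Hr := radius_pos x y H). auto_derive.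
  - simpl in Hr. apply sqrt_lt_0_alt. rewrite sqrt_0. exact Hr.
  - simpl in *. field. lra.
Qed.

Lemma is_derive_radius_y (x y : R) :
  x <> 0 \/ y <> 0 ->
  is_derive (fun t => sqrt (x ^ 2 + t ^ 2)) y (y / sqrt (x ^ 2 + y ^ 2)).
Proof.
  intros H. assert (Hr := radius_pos x y H). auto_derive.
  - simpl in Hr. apply sqrt_lt_0_alt. rewrite sqrt_0. exact Hr.
  - simpl in *. field. lra.
Qed.

Lemma is_derive_quotient (f g : R -> R) (t df dg l : R) :
  is_derive f t df -> is_derive g t dg -> g t <> 0 ->
  l = (df * g t - f t * dg) / (g t) ^ 2 -> is_derive (fun s => f s / g s) t l.
Proof. intros F G H ->. apply is_derive_div; assumption. Qed.

(** The angular rate along x is [- y / r^2]; it is found from the cosine [x / r] and the sine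
    [y / r], which hold on a whole neighbourhood off the axis. *)
Lemma is_cderive_angular_x (j : Z) (x y : R) :
  x <> 0 \/ y <> 0 ->
  is_cderive (fun t => cis (IZR j * polar_angle t y)) x
    (Ci * RtoC (IZR j) * RtoC (- (y / sqrt (x ^ 2 + y ^ 2) / sqrt (x ^ 2 + y ^ 2)))
     * cis (IZR j * polar_angle x y))%C.
Proof.
  intros H. assert (Hr := radius_pos x y H). assert (Hs := radius_sqr x y).
  assert (Hd := is_derive_radius_x x y H).
  assert (Hl : locally x (fun t => t <> 0 \/ y <> 0)).
  { destruct H as [H | H].
    - generalize (locally_neq_0 x H). apply filter_imp. auto.
    - apply filter_forall. auto. }
  apply (is_cderive_cis_Zmult (fun t => polar_angle t y)); cbv beta; rewrite ?cos_polar_angle, ?sin_polar_angle by exact H.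
  - apply (is_derive_ext_loc (fun t => t / sqrt (t ^ 2 + y ^ 2))).
    { revert Hl. apply filter_imp. intros t Ht. symmetry. apply cos_polar_angle, Ht. }
    apply (is_derive_quotient (fun t => t) _ x 1 _ _ (is_derive_id x) Hd); [lra |].
    set (r := sqrt (x ^ 2 + y ^ 2)) in *.
    (* The numerator of the quotient rule is [(r^2 - x^2) / r], that is [y^2 / r] by [Hs]. *)
    replace (1 * r - x * (x / r)) with ((r * r - x ^ 2) / r) by (field; lra).
    rewrite Hs. field. lra.
  - apply (is_derive_ext_loc (fun t => y / sqrt (t ^ 2 + y ^ 2))).
    { revert Hl. apply filter_imp. intros t Ht. symmetry. apply sin_polar_angle, Ht. }
    apply (is_derive_quotient (fun _ => y) _ x 0 _ _ (is_derive_const (K := R_AbsRing) (V := R_NormedModule) y x) Hd); [lra |].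
    field. lra.
Qed.

Lemma is_cderive_angular_y (j : Z) (x y : R) :
  x <> 0 \/ y <> 0 ->
  is_cderive (fun t => cis (IZR j * polar_angle x t)) y
    (Ci * RtoC (IZR j) * RtoC (x / sqrt (x ^ 2 + y ^ 2) / sqrt (x ^ 2 + y ^ 2))
     * cis (IZR j * polar_angle x y))%C.
Proof.
  intros H. assert (Hr := radius_pos x y H). assert (Hs := radius_sqr x y).
  assert (Hd := is_derive_radius_y x y H).
  assert (Hl : locally y (fun t => x <> 0 \/ t <> 0)).
  { destruct H as [H | H].
    - apply filter_forall. auto.
    - generalize (locally_neq_0 y H). apply filter_imp. auto. }
  apply (is_cderive_cis_Zmult (fun t => polar_angle x t)); cbv beta; rewrite ?cos_polar_angle, ?sin_polar_angle by exact H.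
  - apply (is_derive_ext_loc (fun t => x / sqrt (x ^ 2 + t ^ 2))).
    { revert Hl. apply filter_imp. intros t Ht. symmetry. apply cos_polar_angle, Ht. }
    apply (is_derive_quotient (fun _ => x) _ y 0 _ _ (is_derive_const (K := R_AbsRing) (V := R_NormedModule) x y) Hd); [lra |].
    field. lra.
  - apply (is_derive_ext_loc (fun t => t / sqrt (x ^ 2 + t ^ 2))).
    { revert Hl. apply filter_imp. intros t Ht. symmetry. apply sin_polar_angle, Ht. }
    apply (is_derive_quotient (fun t => t) _ y 1 _ _ (is_derive_id y) Hd); [lra |].
    set (r := sqrt (x ^ 2 + y ^ 2)) in *.
    replace (1 * r - y * (y / r)) with ((r * r - y ^ 2) / r) by (field; lra).
    rewrite Hs. field. lra.
Qed.

(** Solves for the partials: [dx] is [(dzeta + dzetabar) / sqrt 2] and [dy] is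
    [Ci * (dzeta - dzetabar) / sqrt 2]. The two factors [1 / sqrt 2], from here and from [dzeta] on
    a mode function, multiply to [1 / 2]. *)
Lemma mode_function_partials_off (j : Z) (phi : R * R -> C) (x y z : R) :
  x <> 0 \/ y <> 0 ->
  is_cderive (fun s => phi (s, z)) (sqrt (x ^ 2 + y ^ 2)) (drad phi (sqrt (x ^ 2 + y ^ 2), z)) ->
  is_cderive (fun s => phi (sqrt (x ^ 2 + y ^ 2), s)) z (dax phi (sqrt (x ^ 2 + y ^ 2), z)) ->
  has_partials_at (x, y, z) (mode_function j phi)
    (RtoC (/ 2) * mode_function (j - 1) (Dop j phi) (x, y, z)
     + RtoC (/ 2) * mode_function (j + 1) (Dop (- j) phi) (x, y, z))%C
    (RtoC (/ 2) * Ci * mode_function (j - 1) (Dop j phi) (x, y, z)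
     + - RtoC (/ 2) * Ci * mode_function (j + 1) (Dop (- j) phi) (x, y, z))%C
    (mode_function j (dax phi) (x, y, z)).
Proof.
  intros H Hr Hz.
  assert (Em : cis (IZR (j - 1) * polar_angle x y)
    = (cis (IZR j * polar_angle x y) *
       (RtoC (x / sqrt (x ^ 2 + y ^ 2)) - Ci * RtoC (y / sqrt (x ^ 2 + y ^ 2))))%C).
  { rewrite minus_IZR.
    replace ((IZR j - 1) * polar_angle x y) with (IZR j * polar_angle x y + - polar_angle x y) by ring.
    rewrite cis_plus. f_equal. unfold cis. rewrite cos_neg, sin_neg.
    rewrite cos_polar_angle, sin_polar_angle by exact H. apply C_eq; simpl; ring. }
  assert (Ep : cis (IZR (j + 1) * polar_angle x y)
    = (cis (IZR j * polar_angle x y) *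
       (RtoC (x / sqrt (x ^ 2 + y ^ 2)) + Ci * RtoC (y / sqrt (x ^ 2 + y ^ 2))))%C).
  { rewrite plus_IZR.
    replace ((IZR j + 1) * polar_angle x y) with (IZR j * polar_angle x y + polar_angle x y) by ring.
    rewrite cis_plus. f_equal. unfold cis.
    rewrite cos_polar_angle, sin_polar_angle by exact H. apply C_eq; simpl; ring. }
  assert (Dx := is_cderive_mult _ _ _ _ _ (is_cderive_angular_x j x y H)
    (is_cderive_comp _ (fun t => sqrt (t ^ 2 + y ^ 2)) x _ _ Hr (is_derive_radius_x x y H))).
  assert (Dy := is_cderive_mult _ _ _ _ _ (is_cderive_angular_y j x y H)
    (is_cderive_comp _ (fun t => sqrt (x ^ 2 + t ^ 2)) y _ _ Hr (is_derive_radius_y x y H))).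
  assert (E2 : (RtoC (/ 2) + RtoC (/ 2))%C = RtoC 1) by (apply C_eq; simpl; field).
  cbv beta in Dx, Dy.
  split; [| split]; cbn [mode_function Dop].
  - match goal with |- is_cderive _ _ ?l => match type of Dx with is_cderive _ _ ?l' =>
      replace l with l'; [exact Dx |] end end.
    rewrite Em, Ep, opp_IZR. set (r := sqrt (x ^ 2 + y ^ 2)) in *.
    set (e := cis (IZR j * polar_angle x y)). set (u := drad phi (r, z)). set (v := phi (r, z)).
    unfold Rdiv. rewrite ?Ropp_mult_distr_l_reverse, ?RtoC_opp, !RtoC_mult.
    set (X := RtoC x). set (Y := RtoC y). set (J := RtoC (IZR j)). set (I := RtoC (/ r)).
    set (h := RtoC (/ 2)) in *.
    (* [RtoC (/ 2)] is an atom [h] for [ring], so the sum [h + h] is isolated first and replaced by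
       1 through [E2]. *)
    transitivity (e * (h + h) * (X * I * u - Ci * Y * I * I * J * v))%C; [rewrite E2; ring | ring].
  - match goal with |- is_cderive _ _ ?l => match type of Dy with is_cderive _ _ ?l' =>
      replace l with l'; [exact Dy |] end end.
    rewrite Em, Ep, opp_IZR. set (r := sqrt (x ^ 2 + y ^ 2)) in *.
    set (e := cis (IZR j * polar_angle x y)). set (u := drad phi (r, z)). set (v := phi (r, z)).
    unfold Rdiv. rewrite ?Ropp_mult_distr_l_reverse, ?RtoC_opp, !RtoC_mult.
    set (X := RtoC x). set (Y := RtoC y). set (J := RtoC (IZR j)). set (I := RtoC (/ r)).
    set (h := RtoC (/ 2)) in *.
    transitivity (e * (h + h) * (Y * I * u + Ci * X * I * I * J * v))%C; [rewrite E2; ring | ring [Ci_sqr]].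
  - apply is_cderive_cst_mult, Hz.
Qed.

(** * Radial coefficients on the open half-plane *)

Lemma cderive_ext_loc (f g : R -> C) (t : R) :
  locally t (fun s => f s = g s) -> cderive f t = cderive g t.
Proof.
  intros H. unfold cderive. f_equal; apply Derive_ext_loc; revert H; apply filter_imp;
    intros s ->; reflexivity.
Qed.

Lemma locally_gt (a r : R) : a < r -> locally r (fun s => a < s).
Proof. intros H. exact (open_gt a r H). Qed.

Lemma locally_lt (a r : R) : r < a -> locally r (fun s => s < a).
Proof. intros H. exact (open_lt a r H). Qed.

Lemma locally_strip (rad r : R) : 0 < r < rad -> locally r (fun s => 0 < s < rad).
Proof.
  intros [H1 H2]. generalize (filter_and _ _ (locally_gt 0 r H1) (locally_lt rad r H2)).
  apply filter_imp. auto.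
Qed.

Lemma locally_fst (P : R -> Prop) (r z : R) :
  locally r P -> locally (r, z) (fun q : R * R => P (fst q)).
Proof. exact (continuous_fst (U := R_UniformSpace) (V := R_UniformSpace) r z P). Qed.

Lemma class_C_strip_continuous (rad : R) (m : nat) (phi : R * R -> C) (r z : R) :
  class_C_strip rad m phi -> 0 < r < rad -> continuous phi (r, z).
Proof. intros H Hr. destruct m; apply H, Hr. Qed.

Lemma class_C_strip_derivatives (rad : R) (m : nat) (phi : R * R -> C) (r z : R) :
  class_C_strip rad (S m) phi -> 0 < r < rad ->
  is_cderive (fun s => phi (s, z)) r (drad phi (r, z)) /\
  is_cderive (fun s => phi (r, s)) z (dax phi (r, z)).
Proof.
  intros (_ & H & _) Hr. destruct (H r z Hr).
  split; apply ex_cderive_is; assumption.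
Qed.

Lemma class_C_strip_ext (rad : R) (m : nat) (phi psi : R * R -> C) :
  (forall r z, 0 < r < rad -> phi (r, z) = psi (r, z)) ->
  class_C_strip rad m phi -> class_C_strip rad m psi.
Proof.
  revert phi psi. induction m as [| m IH]; intros phi psi E H.
  - split; [| exact I]. intros [r z] Hr.
    apply (continuous_ext_loc _ phi); [| apply H, Hr].
    apply (filter_imp (fun q : R * R => 0 < fst q < rad)); [intros [s t] Hs; apply E, Hs |].
    exact (locally_fst _ r z (locally_strip rad r Hr)).
  - assert (D := fun r z => class_C_strip_derivatives rad m phi r z H).
    destruct H as (Hc & _ & H1 & H2).
    assert (L : forall r z, 0 < r < rad -> locally r (fun s => phi (s, z) = psi (s, z))).
    { intros r z Hr. generalize (locally_strip rad r Hr). apply filter_imp. auto. }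
    split; [| split; [| split]].
    + intros [r z] Hr. apply (continuous_ext_loc _ phi); [| apply Hc, Hr].
      apply (filter_imp (fun q : R * R => 0 < fst q < rad)); [intros [s t] Hs; apply E, Hs |].
      exact (locally_fst _ r z (locally_strip rad r Hr)).
    + intros r z Hr. destruct (D r z Hr) as [D1 D2]. split.
      * apply (is_cderive_ex _ _ (drad phi (r, z))).
        exact (is_cderive_ext_loc _ _ _ _ (L r z Hr) D1).
      * apply (is_cderive_ex _ _ (dax phi (r, z))).
        exact (is_cderive_ext _ _ _ _ (fun s => E r s Hr) D2).
    + apply (IH (drad phi)); [| exact H1]. intros r z Hr. apply cderive_ext_loc, L, Hr.
    + apply (IH (dax phi)); [| exact H2]. intros r z Hr. apply cderive_ext_loc.
      apply filter_forall. intros s. apply E, Hr.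
Qed.

Lemma class_C_strip_intro (rad : R) (m : nat) (phi phir phiz : R * R -> C) :
  (forall r z, 0 < r < rad -> continuous phi (r, z)) ->
  (forall r z, 0 < r < rad ->
    is_cderive (fun s => phi (s, z)) r (phir (r, z)) /\
    is_cderive (fun s => phi (r, s)) z (phiz (r, z))) ->
  class_C_strip rad m phir -> class_C_strip rad m phiz ->
  class_C_strip rad (S m) phi.
Proof.
  intros Hc Hd Hr Hz. split; [intros [r z] H; apply Hc, H |]. split; [| split].
  - intros r z H. destruct (Hd r z H). split; eapply is_cderive_ex; eassumption.
  - apply (class_C_strip_ext rad m phir); [| exact Hr]. intros r z H.
    symmetry. apply is_cderive_unique, Hd, H.
  - apply (class_C_strip_ext rad m phiz); [| exact Hz]. intros r z H.
    symmetry. apply is_cderive_unique, Hd, H.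
Qed.

Lemma class_C_strip_S (rad : R) (m : nat) (phi : R * R -> C) :
  class_C_strip rad (S m) phi -> class_C_strip rad m phi.
Proof.
  revert phi. induction m as [| m IH]; intros phi H.
  - split; [apply H | exact I].
  - destruct H as (Hc & Hd & Hr & Hz). split; [exact Hc |]. auto.
Qed.

Lemma class_C_strip_lin (rad : R) (m : nat) (c d : C) (phi psi : R * R -> C) :
  class_C_strip rad m phi -> class_C_strip rad m psi ->
  class_C_strip rad m (fun q => c * phi q + d * psi q)%C.
Proof.
  revert phi psi. induction m as [| m IH]; intros phi psi F G.
  - split; [| exact I]. intros q Hq. apply ccontinuous_lin; [apply F | apply G]; exact Hq.
  - apply (class_C_strip_intro rad m _ (fun q => c * drad phi q + d * drad psi q)%C
      (fun q => c * dax phi q + d * dax psi q)%C).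
    + intros r z H. apply ccontinuous_lin;
        apply (class_C_strip_continuous rad (S m)); assumption.
    + intros r z H. destruct (class_C_strip_derivatives _ _ _ _ z F H) as [F1 F2].
      destruct (class_C_strip_derivatives _ _ _ _ z G H) as [G1 G2].
      split; apply is_cderive_lin; assumption.
    + apply IH; [apply F | apply G].
    + apply IH; [apply F | apply G].
Qed.

Lemma is_cderive_inv (r : R) : r <> 0 -> is_cderive (fun s => RtoC (/ s)) r (RtoC (- (/ r * / r))).
Proof. intros H. apply is_cderive_RtoC. auto_derive; [exact H |]. field. exact H. Qed.

(** The radial derivative of [phi / r] is [phi' / r - (1 / r) (1 / r) phi], again built from
    multiplications by [1 / r]; the induction hypothesis is applied twice to the last term. *)
Lemma class_C_strip_inv (rad : R) (m : nat) (phi : R * R -> C) :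
  class_C_strip rad m phi -> class_C_strip rad m (fun q => RtoC (/ fst q) * phi q)%C.
Proof.
  revert phi. induction m as [| m IH]; intros phi F.
  - split; [| exact I]. intros [r z] Hr. apply ccontinuous_mult; [| apply F, Hr].
    apply ccontinuous_RtoC. apply (continuous_comp fst Rinv); [apply continuous_fst |].
    apply (ex_derive_continuous (K := R_AbsRing) (V := R_NormedModule)).
    destruct Hr. auto_derive. simpl in *. lra.
  - apply (class_C_strip_intro rad m _
      (fun q => RtoC 1 * (RtoC (/ fst q) * drad phi q)
                + - RtoC 1 * (RtoC (/ fst q) * (RtoC (/ fst q) * phi q)))%C
      (fun q => RtoC (/ fst q) * dax phi q)%C).
    + intros r z H. apply (class_C_strip_continuous rad m); [| exact H].
      apply IH, class_C_strip_S, F.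
    + intros r z H. destruct (class_C_strip_derivatives _ _ _ _ z F H) as [F1 F2].
      split; [| apply is_cderive_cst_mult, F2].
      assert (E := is_cderive_mult _ _ _ _ _ (is_cderive_inv r ltac:(lra)) F1).
      cbn [fst]. rewrite RtoC_opp, RtoC_mult in E.
      match goal with |- is_cderive _ _ ?l => match type of E with is_cderive _ _ ?l' =>
        replace l with l'; [exact E | ring] end end.
    + apply class_C_strip_lin; apply IH; [apply F | apply IH, class_C_strip_S, F].
    + apply IH, F.
Qed.

Lemma Dop_unfold (j : Z) (phi : R * R -> C) (r z : R) :
  Dop j phi (r, z) = (drad phi (r, z) + RtoC (IZR j / r) * phi (r, z))%C.
Proof. reflexivity. Qed.

(** Identities between radial operators are stated modulo this relation, because [Dop] has no
    meaning at [r <= 0]. *)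
Definition eq_ray (phi psi : R * R -> C) : Prop :=
  forall r z, 0 < r -> phi (r, z) = psi (r, z).

(** Smoothness on the whole half-plane [r > 0]: the mode functions live on all of R^3, where no
    outer radius remains. *)
Definition smooth_ray (phi : R * R -> C) : Prop :=
  forall rad m, class_C_strip rad m phi.

Lemma eq_ray_refl (phi : R * R -> C) : eq_ray phi phi.
Proof. intros r z _. reflexivity. Qed.

Lemma eq_ray_sym (phi psi : R * R -> C) : eq_ray phi psi -> eq_ray psi phi.
Proof. intros H r z Hr. symmetry. apply H, Hr. Qed.

Lemma eq_ray_trans (phi psi chi : R * R -> C) :
  eq_ray phi psi -> eq_ray psi chi -> eq_ray phi chi.
Proof. intros H1 H2 r z Hr. rewrite H1, H2; auto. Qed.

Lemma smooth_ray_ext (phi psi : R * R -> C) :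
  eq_ray phi psi -> smooth_ray phi -> smooth_ray psi.
Proof.
  intros E H rad m. apply (class_C_strip_ext rad m phi); [| apply H].
  intros r z Hr. apply E, Hr.
Qed.

Lemma smooth_ray_derivatives (phi : R * R -> C) (r z : R) :
  smooth_ray phi -> 0 < r ->
  is_cderive (fun s => phi (s, z)) r (drad phi (r, z)) /\
  is_cderive (fun s => phi (r, s)) z (dax phi (r, z)).
Proof.
  intros H Hr. apply (class_C_strip_derivatives (r + 1) 0); [apply H | lra].
Qed.

Lemma smooth_ray_continuous (phi : R * R -> C) (r z : R) :
  smooth_ray phi -> 0 < r -> continuous phi (r, z).
Proof.
  intros H Hr. apply (class_C_strip_continuous (r + 1) 0); [apply H | lra].
Qed.

Lemma smooth_ray_drad (phi : R * R -> C) : smooth_ray phi -> smooth_ray (drad phi).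
Proof. intros H rad m. apply (H rad (S m)). Qed.

Lemma smooth_ray_dax (phi : R * R -> C) : smooth_ray phi -> smooth_ray (dax phi).
Proof. intros H rad m. apply (H rad (S m)). Qed.

Lemma smooth_ray_Dop (j : Z) (phi : R * R -> C) : smooth_ray phi -> smooth_ray (Dop j phi).
Proof.
  intros H.
  apply (smooth_ray_ext
    (fun q => RtoC 1 * drad phi q + RtoC (IZR j) * (RtoC (/ fst q) * phi q))%C).
  - intros r z Hr. rewrite Dop_unfold. unfold Rdiv. rewrite RtoC_mult. cbn [fst]. ring.
  - intros rad m. apply class_C_strip_lin.
    + apply smooth_ray_drad, H.
    + apply class_C_strip_inv, H.
Qed.

Lemma smooth_ray_Dop_iter (m : nat) (j : Z) (phi : R * R -> C) :
  smooth_ray phi -> smooth_ray (Dop_iter m j phi).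
Proof.
  revert j phi. induction m as [| m IH]; intros j phi H; simpl; auto using smooth_ray_Dop.
Qed.

Lemma drad_eq_ray (phi psi : R * R -> C) : eq_ray phi psi -> eq_ray (drad phi) (drad psi).
Proof.
  intros E r z Hr. apply cderive_ext_loc.
  generalize (locally_gt 0 r Hr). apply filter_imp. intros s Hs. apply E, Hs.
Qed.

Lemma dax_eq_ray (phi psi : R * R -> C) : eq_ray phi psi -> eq_ray (dax phi) (dax psi).
Proof.
  intros E r z Hr. apply cderive_ext_loc, filter_forall. intros s. apply E, Hr.
Qed.

Lemma Dop_eq_ray (j : Z) (phi psi : R * R -> C) :
  eq_ray phi psi -> eq_ray (Dop j phi) (Dop j psi).
Proof.
  intros E r z Hr. rewrite !Dop_unfold, (E r z Hr), (drad_eq_ray _ _ E r z Hr). reflexivity.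
Qed.

Lemma Dop_iter_eq_ray (m : nat) (j : Z) (phi psi : R * R -> C) :
  eq_ray phi psi -> eq_ray (Dop_iter m j phi) (Dop_iter m j psi).
Proof.
  revert j phi psi. induction m as [| m IH]; intros j phi psi E; simpl; auto using Dop_eq_ray.
Qed.

(** The recursion of [Dop_iter] peels off the innermost operator; here it is the outermost one,
    whose index has dropped to [j - m]. *)
Lemma Dop_iter_S (m : nat) (j : Z) (phi : R * R -> C) :
  Dop_iter (S m) j phi = Dop (j - Z.of_nat m) (Dop_iter m j phi).
Proof.
  revert j phi. induction m as [| m IH]; intros j phi.
  - simpl. f_equal. lia.
  - change (Dop_iter (S (S m)) j phi) with (Dop_iter (S m) (j - 1) (Dop j phi)).
    rewrite IH. simpl Dop_iter. f_equal. lia.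
Qed.

Lemma drad_Dop (j : Z) (phi : R * R -> C) (r z : R) :
  smooth_ray phi -> 0 < r ->
  drad (Dop j phi) (r, z)
  = (drad (drad phi) (r, z) + RtoC (IZR j) * RtoC (/ r) * drad phi (r, z)
     - RtoC (IZR j) * RtoC (/ r) * RtoC (/ r) * phi (r, z))%C.
Proof.
  intros H Hr. apply is_cderive_unique.
  destruct (smooth_ray_derivatives phi r z H Hr) as [D1 _].
  destruct (smooth_ray_derivatives _ r z (smooth_ray_drad _ H) Hr) as [D2 _].
  assert (E := is_cderive_plus _ _ _ _ _ D2
    (is_cderive_cst_mult (RtoC (IZR j)) _ _ _
      (is_cderive_mult _ _ _ _ _ (is_cderive_inv r ltac:(lra)) D1))).
  apply (is_cderive_ext (fun s => drad phi (s, z) + RtoC (IZR j) * (RtoC (/ s) * phi (s, z)))%C).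
  { intros s. rewrite Dop_unfold. unfold Rdiv. rewrite RtoC_mult. ring. }
  rewrite RtoC_opp, RtoC_mult in E.
  match goal with |- is_cderive _ _ ?l => match type of E with is_cderive _ _ ?l' =>
    replace l with l'; [exact E | ring] end end.
Qed.

(* Both sides are the Laplacian on mode [l], [d^2/dr^2 + (1/r) d/dr - l^2/r^2]. *)
Lemma Dop_swap (l : Z) (phi : R * R -> C) :
  smooth_ray phi -> eq_ray (Dop (1 - l) (Dop l phi)) (Dop (1 + l) (Dop (- l) phi)).
Proof.
  intros H r z Hr.
  rewrite !(Dop_unfold _ (Dop _ _)), !(Dop_unfold _ phi).
  rewrite !drad_Dop by assumption.
  rewrite minus_IZR, plus_IZR, opp_IZR. unfold Rdiv.
  rewrite !RtoC_mult, RtoC_minus, RtoC_plus, RtoC_opp. ring.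
Qed.

(** Iterates [Dop_swap]: a mode-lowering operator travels inwards past [b] mode-raising ones, its
    index falling from [l + b] to [l], one per exchange. *)
Lemma Dop_comm_iter (b : nat) (l : Z) (phi : R * R -> C) :
  smooth_ray phi ->
  eq_ray (Dop (l + Z.of_nat b) (Dop_iter b (- l) phi)) (Dop_iter b (1 - l) (Dop l phi)).
Proof.
  revert l phi. induction b as [| b IH]; intros l phi H.
  - simpl. rewrite Z.add_0_r. apply eq_ray_refl.
  - simpl Dop_iter.
    replace (l + Z.of_nat (S b))%Z with ((l + 1) + Z.of_nat b)%Z by lia.
    replace (- l - 1)%Z with (- (l + 1))%Z by lia.
    eapply eq_ray_trans; [apply IH, smooth_ray_Dop, H |].
    replace (1 - (l + 1))%Z with (1 - l - 1)%Z by lia.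
    apply Dop_iter_eq_ray. rewrite Z.add_comm. apply eq_ray_sym, Dop_swap, H.
Qed.

Lemma dax_drad (phi : R * R -> C) : smooth_ray phi -> eq_ray (dax (drad phi)) (drad (dax phi)).
Proof.
  intros H r z Hr.
  assert (Hl : locally_2d (fun u v => 0 < u) r z).
  { apply locally_2d_locally. exact (locally_fst _ r z (locally_gt 0 r Hr)). }
  (* Schwarz's theorem is real; an abstract projection [p] covers the real and the imaginary
     part. *)
  assert (K : forall p : C -> R,
    (forall (f : R -> C) t l, is_cderive f t l -> is_derive (fun s => p (f s)) t (p l)) ->
    (forall (f : R * R -> C) q, continuous f q -> continuous (fun u => p (f u)) q) ->
    p (dax (drad phi) (r, z)) = p (drad (dax phi) (r, z))).
  { intros p Hp Hpc.
    assert (Er : forall f u v, smooth_ray f -> 0 < u ->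
      Derive (fun s => p (f (s, v))) u = p (drad f (u, v))).
    { intros f u v Hf Hu. apply is_derive_unique, (Hp (fun s => f (s, v))).
      exact (proj1 (smooth_ray_derivatives f u v Hf Hu)). }
    assert (Ez : forall f u v, smooth_ray f -> 0 < u ->
      Derive (fun s => p (f (u, s))) v = p (dax f (u, v))).
    { intros f u v Hf Hu. apply is_derive_unique, (Hp (fun s => f (u, s))).
      exact (proj2 (smooth_ray_derivatives f u v Hf Hu)). }
    assert (Erz : forall u v, 0 < u ->
      Derive (fun s => Derive (fun t => p (phi (s, t))) v) u = p (drad (dax phi) (u, v))).
    { intros u v Hu. rewrite <- Er by auto using smooth_ray_dax. apply Derive_ext_loc.
      generalize (locally_gt 0 u Hu). apply filter_imp. intros s Hs. apply Ez; assumption. }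
    assert (Ezr : forall u v, 0 < u ->
      Derive (fun t => Derive (fun s => p (phi (s, t))) u) v = p (dax (drad phi) (u, v))).
    { intros u v Hu. rewrite <- Ez by auto using smooth_ray_drad. apply Derive_ext.
      intros t. apply Er; assumption. }
    rewrite <- Erz, <- Ezr by assumption. symmetry.
    apply (Schwarz (fun u v => p (phi (u, v)))).
    - revert Hl. apply locally_2d_impl, locally_2d_forall. intros u v Hu.
      repeat split.
      + eexists. exact (Hp (fun s => phi (s, v)) u _ (proj1 (smooth_ray_derivatives phi u v H Hu))).
      + eexists. exact (Hp (fun s => phi (u, s)) v _ (proj2 (smooth_ray_derivatives phi u v H Hu))).
      + apply (ex_derive_ext_loc (fun s => p (dax phi (s, v)))).
        * generalize (locally_gt 0 u Hu). apply filter_imp. intros s Hs. symmetry. apply Ez; assumption.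
        * eexists. exact (Hp (fun s => dax phi (s, v)) u _
            (proj1 (smooth_ray_derivatives _ u v (smooth_ray_dax _ H) Hu))).
      + apply (ex_derive_ext (fun s => p (drad phi (u, s)))).
        * intros s. symmetry. apply Er; assumption.
        * eexists. exact (Hp (fun s => drad phi (u, s)) v _
            (proj2 (smooth_ray_derivatives _ u v (smooth_ray_drad _ H) Hu))).
    - apply (continuity_2d_pt_ext_loc (fun u v => p (drad (dax phi) (u, v)))).
      + revert Hl. apply locally_2d_impl, locally_2d_forall. intros u v Hu.
        symmetry. apply Erz, Hu.
      + apply continuity_2d_pt_filterlim.
        change (continuous (fun q : R * R => p (drad (dax phi) (fst q, snd q))) (r, z)).
        apply (continuous_ext (fun q => p (drad (dax phi) q))); [intros [u v]; reflexivity |].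
        apply (Hpc (drad (dax phi)) (r, z)), smooth_ray_continuous; auto using smooth_ray_dax, smooth_ray_drad.
    - apply (continuity_2d_pt_ext_loc (fun u v => p (dax (drad phi) (u, v)))).
      + revert Hl. apply locally_2d_impl, locally_2d_forall. intros u v Hu.
        symmetry. apply Ezr, Hu.
      + apply continuity_2d_pt_filterlim.
        change (continuous (fun q : R * R => p (dax (drad phi) (fst q, snd q))) (r, z)).
        apply (continuous_ext (fun q => p (dax (drad phi) q))); [intros [u v]; reflexivity |].
        apply (Hpc (dax (drad phi)) (r, z)), smooth_ray_continuous; auto using smooth_ray_dax, smooth_ray_drad. }
  apply C_eq.
  - apply (K (fun c : C => fst c)); [intros f t l Hd; apply Hd | intros f q; apply ccontinuous_fst].
  - apply (K (fun c : C => snd c)); [intros f t l Hd; apply Hd | intros f q; apply ccontinuous_snd].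
Qed.

Lemma dax_Dop (j : Z) (phi : R * R -> C) :
  smooth_ray phi -> eq_ray (dax (Dop j phi)) (Dop j (dax phi)).
Proof.
  intros H r z Hr.
  rewrite Dop_unfold, <- (dax_drad phi H r z Hr). apply is_cderive_unique, is_cderive_plus.
  - apply smooth_ray_derivatives; auto using smooth_ray_drad.
  - apply is_cderive_cst_mult, smooth_ray_derivatives; assumption.
Qed.

Lemma dax_Dop_iter (m : nat) (j : Z) (phi : R * R -> C) :
  smooth_ray phi -> eq_ray (dax (Dop_iter m j phi)) (Dop_iter m j (dax phi)).
Proof.
  revert j phi. induction m as [| m IH]; intros j phi H.
  - apply eq_ray_refl.
  - simpl. eapply eq_ray_trans; [apply IH, smooth_ray_Dop, H |].
    apply Dop_iter_eq_ray, dax_Dop, H.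
Qed.

(** Every [r > 0] lies either in the original strip or beyond [r0], where [phi] vanishes near the
    point. *)
Lemma class_C_strip_extend (rad r0 : R) (m : nat) (phi : R * R -> C) (rad' : R) :
  r0 < rad -> (forall r z, r0 < r -> phi (r, z) = RtoC 0) ->
  class_C_strip rad m phi -> class_C_strip rad' m phi.
Proof.
  intros Hr0. revert phi. induction m as [| m IH]; intros phi H0 H.
  - split; [| exact I]. intros [r z] [Hr _]. simpl in Hr.
    destruct (Rlt_dec r rad) as [Hl | Hl].
    + apply H. split; assumption.
    + apply (continuous_ext_loc _ (fun _ => RtoC 0)); [| apply continuous_const].
      apply (filter_imp (fun q : R * R => r0 < fst q)); [intros [s t] Hs; symmetry; apply H0, Hs |].
      exact (locally_fst _ r z (locally_gt r0 r ltac:(lra))).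
  - assert (Z0 : forall r z, r0 < r ->
      is_cderive (fun s => phi (s, z)) r (RtoC 0) /\ is_cderive (fun s => phi (r, s)) z (RtoC 0)).
    { intros r z Hr. split.
      - apply (is_cderive_ext_loc (fun _ => RtoC 0)); [| apply is_cderive_const].
        generalize (locally_gt r0 r Hr). apply filter_imp. intros s Hs. symmetry. apply H0, Hs.
      - apply (is_cderive_ext (fun _ => RtoC 0)); [| apply is_cderive_const].
        intros s. symmetry. apply H0, Hr. }
    apply (class_C_strip_intro rad' m phi (drad phi) (dax phi)).
    + intros r z [Hr _]. destruct (Rlt_dec r rad) as [Hl | Hl].
      * apply (class_C_strip_continuous rad (S m)); [exact H | split; assumption].
      * apply (continuous_ext_loc _ (fun _ => RtoC 0)); [| apply continuous_const].
        apply (filter_imp (fun q : R * R => r0 < fst q)); [intros [s t] Hs; symmetry; apply H0, Hs |].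
        exact (locally_fst _ r z (locally_gt r0 r ltac:(lra))).
    + intros r z [Hr _]. destruct (Rlt_dec r rad) as [Hl | Hl].
      * apply (class_C_strip_derivatives rad m); [exact H | split; assumption].
      * assert (Hr' : r0 < r) by lra. destruct (Z0 r z Hr') as [Z1 Z2].
        replace (drad phi (r, z)) with (RtoC 0) by (symmetry; apply is_cderive_unique, Z1).
        replace (dax phi (r, z)) with (RtoC 0) by (symmetry; apply is_cderive_unique, Z2).
        split; assumption.
    + apply IH; [| apply H]. intros r z Hr.
      exact (is_cderive_unique _ _ _ (proj1 (Z0 r z Hr))).
    + apply IH; [| apply H]. intros r z Hr.
      exact (is_cderive_unique _ _ _ (proj2 (Z0 r z Hr))).
Qed.

(** * Extension across the axis *)

(** The mean value theorem writes the difference quotient of [h e] as a value of [dh e], close to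
    [dh 0 s0] by joint continuity. The increment [k] is fixed before [e] is chosen, so continuity of
    [h] in [e] is called upon only at [s0] and [s0 + k]. *)
Lemma is_derive_limit (h dh : R -> R -> R) (s0 : R) :
  (forall e t, e <> 0 -> is_derive (h e) t (dh e t)) ->
  (forall t, continuous (fun e => h e t) 0) ->
  continuous (fun v : R * R => dh (fst v) (snd v)) (0, s0) ->
  is_derive (h 0) s0 (dh 0 s0).
Proof.
  intros Hd Hc Hdc. apply is_derive_Reals. intros eta Heta.
  destruct (proj1 (filterlim_locally _ _) Hdc (mkposreal (eta / 4) ltac:(lra))) as [d Hdelta].
  simpl in Hdelta.
  exists d. intros k Hk Hkd.
  assert (Hpk : 0 < Rabs k) by (apply Rabs_pos_lt, Hk).
  (* Error budget after multiplication by [|k|]: [eta / 8] at each endpoint and [eta / 4] from [dh],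
     in total [eta / 2]. *)
  assert (Hsmall : 0 < eta / 8 * Rabs k) by nra.
  assert (Hnear : forall t, exists e : posreal, forall u, Rabs u < e ->
    Rabs (h u t - h 0 t) < eta / 8 * Rabs k).
  { intros t. destruct (proj1 (filterlim_locally _ _) (Hc t) (mkposreal _ Hsmall)) as [e He].
    exists e. intros u Hu. apply (He u). change (Rabs (u - 0) < e). rewrite Rminus_0_r. exact Hu. }
  destruct (Hnear s0) as [e1 H1]. destruct (Hnear (s0 + k)) as [e2 H2].
  assert (He : exists e, 0 < e /\ e < e1 /\ e < e2 /\ e < d).
  { exists (Rmin e1 (Rmin e2 d) / 2).
    assert (0 < Rmin e1 (Rmin e2 d)) by (repeat apply Rmin_pos; apply cond_pos).
    assert (Rmin e1 (Rmin e2 d) <= e1) by apply Rmin_l.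
    assert (Rmin e1 (Rmin e2 d) <= Rmin e2 d) by apply Rmin_r.
    assert (Rmin e2 d <= e2) by apply Rmin_l.
    assert (Rmin e2 d <= d) by apply Rmin_r. lra. }
  destruct He as (e & He0 & He1 & He2 & Hed).
  assert (Hae : Rabs e = e) by (apply Rabs_pos_eq; lra).
  specialize (H1 e ltac:(lra)). specialize (H2 e ltac:(lra)).
  destruct (MVT_gen (h e) s0 (s0 + k) (dh e)) as (xi & Hxi & Exi).
  - intros t _. apply Hd. lra.
  - intros t _. apply continuity_pt_filterlim.
    apply (ex_derive_continuous (K := R_AbsRing) (V := R_NormedModule)).
    eexists. apply Hd. lra.
  - assert (Hx : Rabs (xi - s0) < d).
    { apply Rle_lt_trans with (Rabs k); [| exact Hkd]. revert Hxi.
      unfold Rmin, Rmax, Rabs. destruct (Rle_dec s0 (s0 + k)); destruct (Rcase_abs (xi - s0));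
        destruct (Rcase_abs k); lra. }
    assert (Hb : Rabs (dh e xi - dh 0 s0) < eta / 4).
    { apply (Hdelta (e, xi)). split; [| exact Hx].
      change (Rabs (e - 0) < d). rewrite Rminus_0_r. lra. }
    replace (s0 + k - s0) with k in Exi by ring.
    replace ((h 0 (s0 + k) - h 0 s0) / k - dh 0 s0)
      with ((- (h e (s0 + k) - h 0 (s0 + k)) + (h e s0 - h 0 s0)
             + (dh e xi - dh 0 s0) * k) / k).
    + unfold Rdiv at 1. rewrite Rabs_mult, Rabs_inv.
      apply (Rmult_lt_reg_r (Rabs k)); [exact Hpk |].
      rewrite Rmult_assoc, Rinv_l, Rmult_1_r by lra.
      eapply Rle_lt_trans; [apply Rabs_triang |].
      assert (T := Rabs_triang (- (h e (s0 + k) - h 0 (s0 + k))) (h e s0 - h 0 s0)).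
      rewrite Rabs_Ropp in T. rewrite Rabs_mult. nra.
    + replace (- (h e (s0 + k) - h 0 (s0 + k)) + (h e s0 - h 0 s0) + (dh e xi - dh 0 s0) * k)
        with (h 0 (s0 + k) - h 0 s0 - dh 0 s0 * k) by lra.
      field. exact Hk.
Qed.

Lemma is_cderive_limit (h dh : R -> R -> C) (s0 : R) :
  (forall e t, e <> 0 -> is_cderive (h e) t (dh e t)) ->
  (forall t, continuous (fun e => h e t) 0) ->
  continuous (fun v : R * R => dh (fst v) (snd v)) (0, s0) ->
  is_cderive (h 0) s0 (dh 0 s0).
Proof.
  intros Hd Hc Hdc. split.
  - apply (is_derive_limit (fun e t => fst (h e t)) (fun e t => fst (dh e t))).
    + intros e t He. apply Hd, He.
    + intros t. apply ccontinuous_fst, Hc.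
    + apply (ccontinuous_fst (fun v : R * R => dh (fst v) (snd v))), Hdc.
  - apply (is_derive_limit (fun e t => snd (h e t)) (fun e t => snd (dh e t))).
    + intros e t He. apply Hd, He.
    + intros t. apply ccontinuous_snd, Hc.
    + apply (ccontinuous_snd (fun v : R * R => dh (fst v) (snd v))), Hdc.
Qed.

(* A line through the axis is approached by parallel lines that avoid the axis. *)
Lemma has_partials_across_axis (f fx fy fz : R3 -> C) :
  (forall q : R3, continuous f q) -> (forall q : R3, continuous fx q) ->
  (forall q : R3, continuous fy q) -> (forall q : R3, continuous fz q) ->
  (forall x y z, x <> 0 \/ y <> 0 ->
    has_partials_at (x, y, z) f (fx (x, y, z)) (fy (x, y, z)) (fz (x, y, z))) ->
  has_partials f fx fy fz.
Proof.
  intros Hf Hx Hy Hz H [[x y] z].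
  destruct (classic (x <> 0 \/ y <> 0)) as [Ho | Ha]; [apply H, Ho |].
  assert (x = 0) by (apply NNPP; tauto). assert (y = 0) by (apply NNPP; tauto). subst x y.
  split; [| split].
  - apply (is_cderive_limit (fun e t => f (t, e, z)) (fun e t => fx (t, e, z))).
    + intros e t He. apply (H t e z). auto.
    + intros t. apply (continuous_comp (fun e => (t, e, z)) f); [solve_continuous | apply Hf].
    + apply (continuous_comp (fun v : R * R => (snd v, fst v, z)) fx); [solve_continuous | apply Hx].
  - apply (is_cderive_limit (fun e t => f (e, t, z)) (fun e t => fy (e, t, z))).
    + intros e t He. apply (H e t z). auto.
    + intros t. apply (continuous_comp (fun e => (e, t, z)) f); [solve_continuous | apply Hf].
    + apply (continuous_comp (fun v : R * R => (fst v, snd v, z)) fy); [solve_continuous | apply Hy].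
  - apply (is_cderive_limit (fun e t => f (e, 0, t)) (fun e t => fz (e, 0, t))).
    + intros e t He. apply (H e 0 t). auto.
    + intros t. apply (continuous_comp (fun e => (e, 0, t)) f); [solve_continuous | apply Hf].
    + apply (continuous_comp (fun v : R * R => (fst v, 0, snd v)) fz); [solve_continuous | apply Hz].
Qed.

Lemma continuous_radius (q : R3) :
  continuous (fun u : R3 => sqrt (fst (fst u) ^ 2 + snd (fst u) ^ 2)) q.
Proof.
  apply (continuous_comp (fun u : R3 => fst (fst u) ^ 2 + snd (fst u) ^ 2) sqrt);
    [| apply continuous_sqrt].
  simpl. unfold R3 in *. solve_continuous.
Qed.

(** The factor [cis] is bounded and may oscillate near [q]; both components of the product are
    dominated by [|Re f| + |Im f|], which tends to 0. *)
Lemma cis_mult_continuous_zero {U : UniformSpace} (theta : U -> R) (f : U -> C) (q : U) :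
  continuous f q -> f q = RtoC 0 -> continuous (fun u => cis (theta u) * f u)%C q.
Proof.
  intros Hc H0.
  assert (K : forall g : U -> R, g q = 0 ->
    (forall u, Rabs (g u) <= Rabs (fst (f u)) + Rabs (snd (f u))) -> continuous g q).
  { intros g Hg Hb. apply (proj2 (filterlim_locally (F := locally q) _ _)). intros eps.
    assert (He : 0 < eps / 2) by (destruct eps; simpl; lra).
    assert (L := proj1 (filterlim_locally _ _) Hc (mkposreal _ He)).
    revert L. apply filter_imp. intros u [L1 L2]. rewrite H0 in L1, L2. simpl in L1, L2.
    change (Rabs (fst (f u) - 0) < eps / 2) in L1. change (Rabs (snd (f u) - 0) < eps / 2) in L2.
    rewrite Rminus_0_r in L1, L2.
    change (Rabs (g u - g q) < eps). rewrite Hg, Rminus_0_r. specialize (Hb u). lra. }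
  assert (B : forall u, Rabs (cos (theta u)) <= 1 /\ Rabs (sin (theta u)) <= 1).
  { intros u. split; apply Rabs_le; [apply COS_bound | apply SIN_bound]. }
  apply ccontinuous_pair; apply K; simpl.
  - rewrite H0. simpl. ring.
  - intros u. eapply Rle_trans; [apply Rabs_triang |]. rewrite Rabs_Ropp, !Rabs_mult.
    destruct (B u). assert (A1 := Rabs_pos (fst (f u))). assert (A2 := Rabs_pos (snd (f u))). nra.
  - rewrite H0. simpl. ring.
  - intros u. eapply Rle_trans; [apply Rabs_triang |]. rewrite !Rabs_mult.
    destruct (B u). assert (A1 := Rabs_pos (fst (f u))). assert (A2 := Rabs_pos (snd (f u))). nra.
Qed.

(** Off the axis the angular factor is continuous through [x / r] and [y / r]. On the axis either
    [j = 0] and the factor is constant, or [psi] vanishes there and tames the factor. *)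
Lemma mode_function_continuous (j : Z) (psi : R * R -> C) (rad r0 : R) :
  continuous_on (half_strip rad) psi -> r0 < rad ->
  (forall r z, 0 <= r -> r0 < r -> psi (r, z) = RtoC 0) ->
  (forall z, j <> 0%Z -> psi (0, z) = RtoC 0) ->
  forall q : R3, continuous (mode_function j psi) q.
Proof.
  intros Hc Hr0 H0 Hax q.
  set (rho := fun u : R3 => sqrt (fst (fst u) ^ 2 + snd (fst u) ^ 2)).
  assert (Hrho : continuous rho q) by apply continuous_radius.
  assert (Hpsi : continuous (fun u : R3 => psi (rho u, snd u)) q).
  (* Continuity of [psi] is relative to the half strip, so neighbourhoods are cut down to
     [rho u < rad]; at [rho q >= rad] the function is locally 0 because [r0 < rad]. *)
  { destruct (Rlt_dec (rho q) rad) as [Hl | Hl].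
    - assert (Hq : half_strip rad (rho q, snd q)) by (split; [apply sqrt_pos | exact Hl]).
      refine (filterlim_comp _ _ _ (fun u : R3 => (rho u, snd u)) psi (locally q) _ _ _ (Hc _ Hq)).
      intros P HP. unfold within in HP.
      assert (Hpair : continuous (fun u : R3 => (rho u, snd u)) q).
      { apply (continuous_pair rho (fun u : R3 => snd u)); [exact Hrho |].
        unfold R3 in *. solve_continuous. }
      assert (L1 := Hpair _ HP).
      assert (L2 := Hrho _ (locally_lt rad (rho q) Hl)).
      unfold filtermap in L1, L2 |- *.
      generalize (filter_and _ _ L1 L2). apply filter_imp. intros u [HPu Hu].
      apply HPu. split; [apply sqrt_pos | exact Hu].
    - apply (continuous_ext_loc _ (fun _ => RtoC 0)); [| apply continuous_const].
      assert (L : locally q (fun u => r0 < rho u)) by (apply (Hrho (fun s => r0 < s)), locally_gt; lra).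
      revert L. apply filter_imp.
      intros u Hu. symmetry. apply H0; [apply sqrt_pos | exact Hu]. }
  assert (E : forall u : R3, (cis (IZR j * polar_angle (fst (fst u)) (snd (fst u)))
    * psi (rho u, snd u))%C = mode_function j psi u).
  { intros [[x y] z]. reflexivity. }
  apply (continuous_ext _ _ q E).
  destruct (classic (fst (fst q) <> 0 \/ snd (fst q) <> 0)) as [Ho | Ha].
  - apply ccontinuous_mult; [| exact Hpsi].
    assert (Hx : continuous (fun u : R3 => fst (fst u)) q) by (unfold R3 in *; solve_continuous).
    assert (Hy : continuous (fun u : R3 => snd (fst u)) q) by (unfold R3 in *; solve_continuous).
    assert (Hl : locally q (fun u : R3 => fst (fst u) <> 0 \/ snd (fst u) <> 0)).
    { destruct Ho as [Ho | Ho].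
      - assert (L : locally q (fun u : R3 => fst (fst u) <> 0))
          by exact (Hx _ (locally_neq_0 _ Ho)).
        revert L. apply filter_imp. auto.
      - assert (L : locally q (fun u : R3 => snd (fst u) <> 0))
          by exact (Hy _ (locally_neq_0 _ Ho)).
        revert L. apply filter_imp. auto. }
    assert (Hp : 0 < rho q) by (apply radius_pos, Ho).
    assert (Hi : continuous (fun u => / rho u) q).
    { apply (continuous_comp rho Rinv); [exact Hrho |].
      apply (ex_derive_continuous (K := R_AbsRing) (V := R_NormedModule)). auto_derive. lra. }
    apply continuous_cis_Zmult.
    + apply (continuous_ext_loc _ (fun u : R3 => fst (fst u) * / rho u)).
      * revert Hl. apply filter_imp. intros u Hu. symmetry. apply cos_polar_angle, Hu.
      * apply continuous_Rmult; assumption.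
    + apply (continuous_ext_loc _ (fun u : R3 => snd (fst u) * / rho u)).
      * revert Hl. apply filter_imp. intros u Hu. symmetry. apply sin_polar_angle, Hu.
      * apply continuous_Rmult; assumption.
  - destruct (Z.eq_dec j 0) as [-> | Hj].
    + apply ccontinuous_mult; [| exact Hpsi].
      apply (continuous_ext (fun _ => cis 0)); [| apply continuous_const].
      intros u. rewrite Rmult_0_l. reflexivity.
    + apply (cis_mult_continuous_zero
        (fun u : R3 => IZR j * polar_angle (fst (fst u)) (snd (fst u)))); [exact Hpsi |].
      replace (rho q) with 0; [apply Hax, Hj |].
      assert (E1 : fst (fst q) = 0) by (apply NNPP; tauto).
      assert (E2 : snd (fst q) = 0) by (apply NNPP; tauto).
      unfold rho. rewrite E1, E2. replace (0 ^ 2 + 0 ^ 2) with 0 by ring. symmetry. apply sqrt_0.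
Qed.

Lemma axis_ext_pos (phi : R * R -> C) (r z : R) : 0 < r -> axis_ext phi (r, z) = phi (r, z).
Proof. intros H. simpl. destruct (Rlt_dec 0 r); [reflexivity | contradiction]. Qed.

Lemma axis_ext_eq_ray (phi : R * R -> C) : eq_ray (axis_ext phi) phi.
Proof. intros r z Hr. apply axis_ext_pos, Hr. Qed.

(** [lim] is specified on Cauchy filters only: a convergent filter is Cauchy, and uniqueness of
    limits identifies the value. *)
Lemma axis_ext_limit (phi : R * R -> C) (z : R) (l : C) :
  filterlim (fun s => phi (s, z)) (at_right 0) (locally l) ->
  axis_ext phi (0, z) = l.
Proof.
  intros H. simpl. destruct (Rlt_dec 0 0) as [Hc | _]; [lra |].
  set (F := filtermap (fun s => phi (s, z)) (at_right 0)) in *.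
  assert (FF : ProperFilter F) by (apply filtermap_proper_filter, at_right_proper_filter).
  assert (Hl : @filterlim C C (fun x => x) F (locally (T := C_R_NormedModule) l)).
  { intros P HP. exact (H P HP). }
  assert (HC : @cauchy C_UniformSpace F).
  { intros eps. exists l. apply H. exists eps. auto. }
  apply (filterlim_locally_unique (K := R_AbsRing) (V := C_R_NormedModule) (F := F) (fun x => x)); [| exact Hl].
  intros P [eps HP]. generalize (complete_cauchy (T := C_R_CompleteNormedModule) F FF HC eps).
  apply (filter_imp (F := F)). intros x Hx. exact (HP x Hx).
Qed.

(** * From radial coefficients to mode functions *)

Definition mixed_radial (j : Z) (phi : R * R -> C) (a b c : nat) : R * R -> C :=
  Dop_iter b (- j + Z.of_nat a) (Dop_iter a j (Nat.iter c dax phi)).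

(** The function [G a b c] of the overview: each of the [a] inner operators lowers the mode by one,
    each of the [b] outer ones raises it. *)
Definition mixed_mode (j : Z) (phi : R * R -> C) (a b c : nat) : R3 -> C :=
  mode_function (j - Z.of_nat a + Z.of_nat b) (axis_ext (mixed_radial j phi a b c)).

Lemma smooth_ray_dax_iter (c : nat) (phi : R * R -> C) :
  smooth_ray phi -> smooth_ray (Nat.iter c dax phi).
Proof. intros H. apply Nat_iter_ind; [exact smooth_ray_dax | exact H]. Qed.

Lemma smooth_ray_mixed (j : Z) (phi : R * R -> C) (a b c : nat) :
  smooth_ray phi -> smooth_ray (mixed_radial j phi a b c).
Proof. intros H. apply smooth_ray_Dop_iter, smooth_ray_Dop_iter, smooth_ray_dax_iter, H. Qed.

(** A further lowering operator arrives on the outside and must pass the [b] raising ones to restore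
    the normal form. A raising operator is already in place, whence the plain equality in
    [mixed_radial_S_r]. *)
Lemma mixed_radial_S_l (j : Z) (phi : R * R -> C) (a b c : nat) :
  smooth_ray phi ->
  eq_ray (Dop (j - Z.of_nat a + Z.of_nat b) (mixed_radial j phi a b c))
    (mixed_radial j phi (S a) b c).
Proof.
  intros H. unfold mixed_radial. rewrite Dop_iter_S.
  replace (- j + Z.of_nat a)%Z with (- (j - Z.of_nat a))%Z by lia.
  replace (- j + Z.of_nat (S a))%Z with (1 - (j - Z.of_nat a))%Z by lia.
  apply Dop_comm_iter, smooth_ray_Dop_iter, smooth_ray_dax_iter, H.
Qed.

Lemma mixed_radial_S_r (j : Z) (phi : R * R -> C) (a b c : nat) :
  Dop (- (j - Z.of_nat a + Z.of_nat b)) (mixed_radial j phi a b c)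
  = mixed_radial j phi a (S b) c.
Proof. unfold mixed_radial. rewrite Dop_iter_S. f_equal. lia. Qed.

Lemma mixed_radial_dax (j : Z) (phi : R * R -> C) (a b c : nat) :
  smooth_ray phi ->
  eq_ray (dax (mixed_radial j phi a b c)) (mixed_radial j phi a b (S c)).
Proof.
  intros H. assert (Hc := smooth_ray_dax_iter c phi H). unfold mixed_radial.
  eapply eq_ray_trans; [apply dax_Dop_iter, smooth_ray_Dop_iter, Hc |].
  apply Dop_iter_eq_ray. apply (dax_Dop_iter a j _ Hc).
Qed.

Lemma mode_function_eq_ray (j : Z) (phi psi : R * R -> C) (x y z : R) :
  eq_ray phi psi -> x <> 0 \/ y <> 0 ->
  mode_function j phi (x, y, z) = mode_function j psi (x, y, z).
Proof. intros E H. simpl. rewrite E by (apply radius_pos, H). reflexivity. Qed.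

Lemma mixed_mode_partials_off (j : Z) (phi : R * R -> C) (a b c : nat) (x y z : R) :
  smooth_ray phi -> x <> 0 \/ y <> 0 ->
  has_partials_at (x, y, z) (mixed_mode j phi a b c)
    (RtoC (/ 2) * mixed_mode j phi (S a) b c (x, y, z)
     + RtoC (/ 2) * mixed_mode j phi a (S b) c (x, y, z))%C
    (RtoC (/ 2) * Ci * mixed_mode j phi (S a) b c (x, y, z)
     + - RtoC (/ 2) * Ci * mixed_mode j phi a (S b) c (x, y, z))%C
    (mixed_mode j phi a b (S c) (x, y, z)).
Proof.
  intros H Ho. set (l := (j - Z.of_nat a + Z.of_nat b)%Z).
  set (psi := axis_ext (mixed_radial j phi a b c)).
  assert (Epsi : eq_ray psi (mixed_radial j phi a b c)) by apply axis_ext_eq_ray.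
  assert (Hpsi : smooth_ray psi).
  { apply (smooth_ray_ext (mixed_radial j phi a b c)); [apply eq_ray_sym, Epsi |].
    apply smooth_ray_mixed, H. }
  assert (E1 : mixed_mode j phi (S a) b c (x, y, z) = mode_function (l - 1) (Dop l psi) (x, y, z)).
  { unfold mixed_mode. replace (j - Z.of_nat (S a) + Z.of_nat b)%Z with (l - 1)%Z by lia.
    apply mode_function_eq_ray; [| exact Ho].
    eapply eq_ray_trans; [apply axis_ext_eq_ray |].
    eapply eq_ray_trans; [apply eq_ray_sym, mixed_radial_S_l, H |].
    apply Dop_eq_ray, eq_ray_sym, Epsi. }
  assert (E2 : mixed_mode j phi a (S b) c (x, y, z) = mode_function (l + 1) (Dop (- l) psi) (x, y, z)).
  { unfold mixed_mode. replace (j - Z.of_nat a + Z.of_nat (S b))%Z with (l + 1)%Z by lia.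
    apply mode_function_eq_ray; [| exact Ho].
    eapply eq_ray_trans; [apply axis_ext_eq_ray |].
    rewrite <- mixed_radial_S_r. apply Dop_eq_ray, eq_ray_sym, Epsi. }
  assert (E3 : mixed_mode j phi a b (S c) (x, y, z) = mode_function l (dax psi) (x, y, z)).
  { apply mode_function_eq_ray; [| exact Ho].
    eapply eq_ray_trans; [apply axis_ext_eq_ray |].
    eapply eq_ray_trans; [apply eq_ray_sym, mixed_radial_dax, H |].
    apply dax_eq_ray, eq_ray_sym, Epsi. }
  rewrite E1, E2, E3.
  destruct (smooth_ray_derivatives psi (sqrt (x ^ 2 + y ^ 2)) z Hpsi (radius_pos x y Ho)).
  apply mode_function_partials_off; assumption.
Qed.

Lemma mixed_mode_partials (j : Z) (phi : R * R -> C) (a b c : nat) :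
  smooth_ray phi -> (forall a b c (q : R3), continuous (mixed_mode j phi a b c) q) ->
  has_partials (mixed_mode j phi a b c)
    (fun q => RtoC (/ 2) * mixed_mode j phi (S a) b c q
              + RtoC (/ 2) * mixed_mode j phi a (S b) c q)%C
    (fun q => RtoC (/ 2) * Ci * mixed_mode j phi (S a) b c q
              + - RtoC (/ 2) * Ci * mixed_mode j phi a (S b) c q)%C
    (mixed_mode j phi a b (S c)).
Proof.
  intros H Hc. apply has_partials_across_axis.
  - apply Hc.
  - intros q. apply ccontinuous_lin; apply Hc.
  - intros q. apply ccontinuous_lin; apply Hc.
  - apply Hc.
  - intros x y z Ho. apply mixed_mode_partials_off; assumption.
Qed.

Lemma mixed_mode_smooth (j : Z) (phi : R * R -> C) (a b c : nat) :
  smooth_ray phi -> (forall a b c (q : R3), continuous (mixed_mode j phi a b c) q) ->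
  smooth (mixed_mode j phi a b c).
Proof.
  intros H Hc m. revert a b c. induction m as [| m IH]; intros a b c.
  - split; [apply Hc | exact I].
  - apply (class_C_intro _ _ _ _ _ (Hc a b c) (mixed_mode_partials j phi a b c H Hc));
      try apply class_C_lin; apply IH.
Qed.

Lemma dzeta_scal (s : C) (g : R3 -> C) :
  smooth g -> dzeta (fun q => s * g q)%C = (fun q => s * dzeta g q)%C.
Proof.
  intros Hg. apply functional_extensionality. intros q.
  assert (P : has_partials_at q (fun q => s * g q)%C (s * dx g q)%C (s * dy g q)%C (s * dz g q)%C).
  { destruct q as [[x y] z]. destruct (smooth_partials g Hg (x, y, z)) as (Px & Py & Pz).
    split; [| split]; apply is_cderive_cst_mult; assumption. }
  destruct (has_partials_at_unique _ _ _ _ _ P) as (Ex & Ey & _).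
  unfold dzeta. rewrite Ex, Ey. ring.
Qed.

Lemma dzetabar_scal (s : C) (g : R3 -> C) :
  smooth g -> dzetabar (fun q => s * g q)%C = (fun q => s * dzetabar g q)%C.
Proof.
  intros Hg. apply functional_extensionality. intros q.
  assert (P : has_partials_at q (fun q => s * g q)%C (s * dx g q)%C (s * dy g q)%C (s * dz g q)%C).
  { destruct q as [[x y] z]. destruct (smooth_partials g Hg (x, y, z)) as (Px & Py & Pz).
    split; [| split]; apply is_cderive_cst_mult; assumption. }
  destruct (has_partials_at_unique _ _ _ _ _ P) as (Ex & Ey & _).
  unfold dzetabar. rewrite Ex, Ey. ring.
Qed.

Lemma half_plus_half : (RtoC (/ 2) + RtoC (/ 2))%C = RtoC 1.
Proof. apply C_eq; simpl; field. Qed.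

(** Reads off [dzeta] and [dzetabar] from partials in the shape given by
    [mode_function_partials_off] and [mixed_mode_partials]. *)
Lemma has_partials_at_dzeta (q : R3) (f : R3 -> C) (u v w : C) :
  has_partials_at q f (RtoC (/ 2) * u + RtoC (/ 2) * v)%C
    (RtoC (/ 2) * Ci * u + - RtoC (/ 2) * Ci * v)%C w ->
  dzeta f q = (RtoC (/ sqrt 2) * u)%C /\ dzetabar f q = (RtoC (/ sqrt 2) * v)%C.
Proof.
  intros P. destruct (has_partials_at_unique _ _ _ _ _ P) as (Ex & Ey & _).
  unfold dzeta, dzetabar. rewrite Ex, Ey. split.
  - transitivity (RtoC (/ sqrt 2) * ((RtoC (/ 2) + RtoC (/ 2)) * u))%C;
      [ring [Ci_sqr] | rewrite half_plus_half; ring].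
  - transitivity (RtoC (/ sqrt 2) * ((RtoC (/ 2) + RtoC (/ 2)) * v))%C;
      [ring [Ci_sqr] | rewrite half_plus_half; ring].
Qed.

Lemma zeta_deriv_mixed_mode (j : Z) (phi : R * R -> C) (a b c : nat) :
  smooth_ray phi -> (forall a b c (q : R3), continuous (mixed_mode j phi a b c) q) ->
  Nat.iter b dzetabar (Nat.iter a dzeta (Nat.iter c dz (mixed_mode j phi 0 0 0)))
  = (fun q => RtoC ((/ sqrt 2) ^ (a + b)) * mixed_mode j phi a b c q)%C.
Proof.
  intros H Hc.
  assert (Ez : Nat.iter c dz (mixed_mode j phi 0 0 0) = mixed_mode j phi 0 0 c).
  { induction c as [| c IH]; [reflexivity |]. simpl. rewrite IH.
    apply (has_partials_unique _ _ _ _ (mixed_mode_partials j phi 0 0 c H Hc)). }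
  rewrite Ez.
  assert (Ea : Nat.iter a dzeta (mixed_mode j phi 0 0 c)
    = (fun q => RtoC ((/ sqrt 2) ^ a) * mixed_mode j phi a 0 c q)%C).
  { clear Ez. induction a as [| a IH].
    - apply functional_extensionality. intros q. simpl. ring.
    - simpl Nat.iter. rewrite IH, dzeta_scal by (apply mixed_mode_smooth; assumption).
      apply functional_extensionality. intros q.
      destruct (has_partials_at_dzeta _ _ _ _ _ (mixed_mode_partials j phi a 0 c H Hc q)) as [-> _].
      simpl pow. rewrite RtoC_mult. ring. }
  rewrite Ea. clear Ez Ea.
  induction b as [| b IH].
  - rewrite Nat.add_0_r. reflexivity.
  - simpl Nat.iter. rewrite IH, dzetabar_scal by (apply mixed_mode_smooth; assumption).
    apply functional_extensionality. intros q.
    destruct (has_partials_at_dzeta _ _ _ _ _ (mixed_mode_partials j phi a b c H Hc q)) as [_ ->].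
    rewrite Nat.add_succ_r. simpl pow. rewrite RtoC_mult. ring.
Qed.

Definition zero_beyond (r0 : R) (phi : R * R -> C) : Prop :=
  forall r z, r0 < r -> phi (r, z) = RtoC 0.

Lemma zero_beyond_derivatives (r0 : R) (phi : R * R -> C) :
  zero_beyond r0 phi -> zero_beyond r0 (drad phi) /\ zero_beyond r0 (dax phi).
Proof.
  intros H. split; intros r z Hr; apply is_cderive_unique.
  - apply (is_cderive_ext_loc (fun _ => RtoC 0)); [| apply is_cderive_const].
    generalize (locally_gt r0 r Hr). apply filter_imp. intros s Hs. symmetry. apply H, Hs.
  - apply (is_cderive_ext (fun _ => RtoC 0)); [| apply is_cderive_const].
    intros s. symmetry. apply H, Hr.
Qed.

Lemma zero_beyond_Dop_iter (r0 : R) (m : nat) (j : Z) (phi : R * R -> C) :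
  zero_beyond r0 phi -> zero_beyond r0 (Dop_iter m j phi).
Proof.
  revert j phi. induction m as [| m IH]; intros j phi H; [exact H |]. simpl. apply IH.
  intros r z Hr. rewrite Dop_unfold, H by exact Hr.
  rewrite (proj1 (zero_beyond_derivatives r0 phi H) r z Hr). ring.
Qed.

Lemma zero_beyond_mixed (r0 : R) (j : Z) (phi : R * R -> C) (a b c : nat) :
  zero_beyond r0 phi -> zero_beyond r0 (mixed_radial j phi a b c).
Proof.
  intros H. apply zero_beyond_Dop_iter, zero_beyond_Dop_iter.
  apply Nat_iter_ind; [| exact H]. intros psi Hpsi. apply zero_beyond_derivatives, Hpsi.
Qed.

Lemma radial_test_smooth_ray (rad : R) (j : Z) (phi : R * R -> C) :
  radial_test_function rad j phi -> smooth_ray phi.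
Proof.
  intros ((r0 & z0 & Hr & Hz & H0) & Hs & _) rad' m.
  apply (class_C_strip_extend rad r0); [lra | | apply Hs].
  intros r z H. apply H0; [lra | auto].
Qed.

Lemma IZR_mult_eq_0 (l : Z) (u : C) :
  l <> 0%Z -> (RtoC (IZR l) * u)%C = RtoC 0 -> u = RtoC 0.
Proof.
  intros Hl E. apply not_0_IZR in Hl. destruct u as [a b].
  injection E as E1 E2. apply C_eq; simpl; apply (Rmult_eq_reg_l (IZR l)); lra.
Qed.

(** The clause of [radial_test_function] with [i = a], [n = a + b], [p = a + b + c]: its factor
    [j + n - 2 i] is the mode [j - a + b], so a nonzero mode forces the coefficient to vanish on the
    axis. *)
Lemma radial_test_mixed_continuous (rad : R) (j : Z) (phi : R * R -> C) :
  radial_test_function rad j phi ->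
  forall a b c (q : R3), continuous (mixed_mode j phi a b c) q.
Proof.
  intros ((r0 & z0 & Hr & Hz & H0) & _ & _ & H) a b c.
  destruct (H a (a + b)%nat (a + b + c)%nat ltac:(lia) ltac:(lia)) as [Hc Hax].
  unfold radial_deriv in Hc, Hax.
  replace (a + b - a)%nat with b in Hc, Hax by lia.
  replace (a + b + c - (a + b))%nat with c in Hc, Hax by lia.
  apply (mode_function_continuous _ _ rad r0); [exact Hc | lra | |].
  - intros r z _ Hrr. rewrite axis_ext_pos by lra. apply (zero_beyond_mixed r0); [| exact Hrr].
    intros s t Hs. apply H0; [lra | auto].
  - intros z Hl. specialize (Hax z).
    replace (j + Z.of_nat (a + b) - 2 * Z.of_nat a)%Z with (j - Z.of_nat a + Z.of_nat b)%Z in Hax by lia.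
    exact (IZR_mult_eq_0 _ _ Hl Hax).
Qed.

Lemma continuous_on_axis_limit (rad : R) (phi : R * R -> C) (z : R) :
  0 < rad -> continuous_on (half_strip rad) phi ->
  filterlim (fun s => phi (s, z)) (at_right 0) (locally (phi (0, z))).
Proof.
  intros Hrad H.
  assert (Hz : half_strip rad (0, z)) by (split; simpl; lra).
  refine (filterlim_comp _ _ _ (fun s => (s, z)) phi _ _ _ _ (H _ Hz)).
  intros P [d Hd].
  (* The minimum with [rad] keeps [(s, z)] inside the half strip. *)
  exists (mkposreal (Rmin d rad) (Rmin_pos _ _ (cond_pos d) Hrad)).
  intros s Hs Hs0. change (Rabs (s - 0) < Rmin d rad) in Hs. rewrite Rminus_0_r in Hs.
  rewrite Rabs_pos_eq in Hs by lra.
  assert (Rmin d rad <= d) by apply Rmin_l. assert (Rmin d rad <= rad) by apply Rmin_r.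
  apply Hd.
  - split; [| apply ball_center]. change (Rabs (s - 0) < d). rewrite Rminus_0_r, Rabs_pos_eq; lra.
  - split; simpl; lra.
Qed.

Lemma mixed_mode_0 (rad : R) (j : Z) (phi : R * R -> C) :
  0 < rad -> continuous_on (half_strip rad) phi -> mixed_mode j phi 0 0 0 = mode_function j phi.
Proof.
  intros Hrad Hc. unfold mixed_mode, mixed_radial. simpl.
  replace (j - 0 + 0)%Z with j by lia.
  apply mode_function_ext. intros r z [Hr | <-]; [apply axis_ext_pos, Hr |].
  apply axis_ext_limit, (continuous_on_axis_limit rad); assumption.
Qed.

Lemma mode_function_is_mode (j : Z) (phi : R * R -> C) :
  (j <> 0%Z -> forall z, phi (0, z) = RtoC 0) -> is_mode j (mode_function j phi).
Proof.
  intros H0. exists phi. split; [| exact H0]. intros r t z Hr. simpl mode_function.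
  replace ((r * cos t) * ((r * cos t) * 1) + (r * sin t) * ((r * sin t) * 1))
    with (r ^ 2 * (Rsqr (sin t) + Rsqr (cos t))) by (unfold Rsqr; ring).
  rewrite sin2_cos2, Rmult_1_r, sqrt_pow2 by exact Hr.
  (* For [r > 0] the angles [t] and [polar_angle] have the same [cis]. At [r = 0] they are
     unrelated, but then the mode is 0 or the coefficient vanishes. *)
  destruct Hr as [Hr | <-].
  - f_equal. apply cis_Zmult_eq.
    assert (E : sqrt ((r * cos t) ^ 2 + (r * sin t) ^ 2) = r).
    { replace ((r * cos t) ^ 2 + (r * sin t) ^ 2)
        with (r ^ 2 * (Rsqr (sin t) + Rsqr (cos t))) by (unfold Rsqr; ring).
      rewrite sin2_cos2, Rmult_1_r. apply sqrt_pow2. lra. }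
    assert (Ec := polar_radius_cos (r * cos t) (r * sin t)).
    assert (Es := polar_radius_sin (r * cos t) (r * sin t)).
    rewrite E in Ec, Es. unfold cis.
    apply C_eq; simpl; apply (Rmult_eq_reg_l r); lra.
  - destruct (Z.eq_dec j 0) as [-> | Hj].
    + rewrite !Rmult_0_l. reflexivity.
    + rewrite H0 by exact Hj. ring.
Qed.

Lemma radial_test_mode_test (rad : R) (j : Z) (phi : R * R -> C) :
  radial_test_function rad j phi -> mode_test_function rad j (mode_function j phi).
Proof.
  intros H. assert (Hs := radial_test_smooth_ray rad j phi H).
  assert (Hm := radial_test_mixed_continuous rad j phi H).
  destruct H as ((r0 & z0 & Hr & Hz & H0) & _ & Hc & H).
  assert (E := mixed_mode_0 rad j phi ltac:(lra) Hc).
  split; [split |].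
  - rewrite <- E. apply mixed_mode_smooth; assumption.
  - exists r0, z0. split; [exact Hr | split; [exact Hz |]]. intros [[x y] z] Hq.
    cbn [mode_function]. rewrite H0; [ring | apply sqrt_pos |].
    destruct (Rlt_dec r0 (sqrt (x ^ 2 + y ^ 2))); [auto | right].
    apply Rnot_le_lt. intros Hzz. apply Hq. split; [lra | exact Hzz].
  - apply mode_function_is_mode. intros Hj z.
    (* The clause without derivatives says [j * phi (0, z) = 0]. *)
    destruct (H 0%nat 0%nat 0%nat ltac:(lia) ltac:(lia)) as [_ Hax]. specialize (Hax z).
    replace (radial_deriv j 0 0 0 phi (0, z)) with (phi (0, z)) in Hax.
    + apply (IZR_mult_eq_0 (j + Z.of_nat 0 - 2 * Z.of_nat 0)); [lia | exact Hax].
    + symmetry. apply axis_ext_limit, (continuous_on_axis_limit rad); [lra | exact Hc].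
Qed.

Lemma Rpower_half (n : nat) : Rpower 2 (- (INR n / 2)) = (/ sqrt 2) ^ n.
Proof.
  rewrite <- (Rpower_sqrt 2) by lra. rewrite <- Rpower_Ropp.
  rewrite <- Rpower_pow by apply exp_pos. rewrite Rpower_mult. f_equal. field.
Qed.

Lemma mode_function_scal (j : Z) (s : C) (phi : R * R -> C) :
  mode_function j (fun q => s * phi q)%C = (fun q => s * mode_function j phi q)%C.
Proof. apply functional_extensionality. intros [[x y] z]. simpl. ring. Qed.

(** The normal form with [a = n - i], [b = i], [c = p - n]. The resulting mode is [k], the outer
    operators start at index [- k + i], and each of the [n] zeta derivatives contributes
    [1 / sqrt 2]. *)
Lemma zeta_deriv_mode_function (rad : R) (k : Z) (i n p : nat) (phi : R * R -> C) :
  (i <= n)%nat -> radial_test_function rad (target_mode k i n) phi ->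
  zeta_deriv i n p (mode_function (target_mode k i n) phi)
  = mode_function k (fun q : R * R =>
      (RtoC (Rpower 2 (- (INR n / 2))) *
       axis_ext
         (Dop_iter i (- k + Z.of_nat i)
           (Dop_iter (n - i) (target_mode k i n)
             (Nat.iter (p - n) dax phi))) q)%C).
Proof.
  intros Hi H. assert (Hs := radial_test_smooth_ray _ _ _ H).
  assert (Hm := radial_test_mixed_continuous _ _ _ H).
  destruct H as ((r0 & z0 & Hr & _) & _ & Hc & _).
  rewrite <- (mixed_mode_0 rad) by (exact Hc || lra).
  unfold zeta_deriv. rewrite zeta_deriv_mixed_mode by assumption.
  rewrite mode_function_scal, Rpower_half.
  replace (n - i + i)%nat with n by lia.
  unfold mixed_mode, mixed_radial.
  replace (target_mode k i n - Z.of_nat (n - i) + Z.of_nat i)%Z with k by (unfold target_mode; lia).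
  replace (- target_mode k i n + Z.of_nat (n - i))%Z with (- k + Z.of_nat i)%Z by (unfold target_mode; lia).
  reflexivity.
Qed.

(** * From mode functions to radial coefficients *)

Lemma continuous_trace (f : R3 -> C) (q : R * R) :
  (forall q : R3, continuous f q) -> continuous (trace f) q.
Proof.
  intros Hf. apply (continuous_ext (fun u : R * R => f (fst u, 0, snd u)));
    [intros [r z]; reflexivity |].
  apply (continuous_comp (fun u : R * R => (fst u, 0, snd u)) f); [solve_continuous | apply Hf].
Qed.

Lemma trace_class_C (rad : R) (m : nat) (f : R3 -> C) :
  class_C m f -> class_C_strip rad m (trace f).
Proof.
  revert f. induction m as [| m IH]; intros f H.
  - split; [| exact I]. intros q _. apply continuous_trace, H.
  - assert (P := class_C_partials m f H). destruct H as (Hc & _ & Hx & _ & Hz).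
    apply (class_C_strip_intro rad m _ (trace (dx f)) (trace (dz f))).
    + intros r z _. apply continuous_trace, Hc.
    + intros r z _. destruct (P (r, 0, z)) as (Px & _ & Pz). split; assumption.
    + apply IH, Hx.
    + apply IH, Hz.
Qed.

Lemma smooth_ray_trace (f : R3 -> C) : smooth f -> smooth_ray (trace f).
Proof. intros H rad m. apply trace_class_C, H. Qed.

Lemma mode_function_ray (j : Z) (phi : R * R -> C) (r z : R) :
  0 < r -> mode_function j phi (r, 0, z) = phi (r, z).
Proof.
  intros Hr. cbn [mode_function].
  assert (E : sqrt (r ^ 2 + 0 ^ 2) = r).
  { replace (r ^ 2 + 0 ^ 2) with (r ^ 2) by ring. apply sqrt_pow2. lra. }
  rewrite E, (cis_Zmult_eq _ 0), Rmult_0_r, cis_0; [ring |].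
  unfold cis. rewrite cos_polar_angle, sin_polar_angle, E, cos_0, sin_0 by (left; lra).
  apply C_eq; simpl; field; lra.
Qed.

(** An equivariant function is its own average, so its derivative is an average of the neighbouring
    mode, and averages are equivariant. *)
Lemma equivariant_dzeta (l : Z) (g : R3 -> C) :
  smooth g -> equivariant l g -> equivariant (l - 1) (dzeta g).
Proof.
  intros Hg He. rewrite <- (equivariant_mean l g He), mean_dzeta by exact Hg.
  apply mean_equivariant. intros q. apply smooth_continuous, smooth_dzeta, Hg.
Qed.

Lemma equivariant_dzetabar (l : Z) (g : R3 -> C) :
  smooth g -> equivariant l g -> equivariant (l + 1) (dzetabar g).
Proof.
  intros Hg He. rewrite <- (equivariant_mean l g He), mean_dzetabar by exact Hg.
  apply mean_equivariant. intros q. apply smooth_continuous, smooth_dzetabar, Hg.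
Qed.

Lemma equivariant_dz (l : Z) (g : R3 -> C) :
  smooth g -> equivariant l g -> equivariant l (dz g).
Proof.
  intros Hg He. rewrite <- (equivariant_mean l g He), mean_dz by exact Hg.
  apply mean_equivariant. intros q. apply smooth_continuous, smooth_dz, Hg.
Qed.

Lemma trace_dzeta (l : Z) (g : R3 -> C) :
  smooth g -> equivariant l g ->
  eq_ray (Dop l (trace g)) (fun q => RtoC (sqrt 2) * trace (dzeta g) q)%C /\
  eq_ray (Dop (- l) (trace g)) (fun q => RtoC (sqrt 2) * trace (dzetabar g) q)%C.
Proof.
  intros Hg He.
  assert (H2 : (RtoC (sqrt 2) * RtoC (/ sqrt 2))%C = RtoC 1).
  { rewrite <- RtoC_mult, Rinv_r; [reflexivity |].
    assert (0 < sqrt 2) by (apply sqrt_lt_R0; lra). lra. }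
  assert (K : forall r z, 0 < r ->
    dzeta g (r, 0, z) = (RtoC (/ sqrt 2) * Dop l (trace g) (r, z))%C /\
    dzetabar g (r, 0, z) = (RtoC (/ sqrt 2) * Dop (- l) (trace g) (r, z))%C).
  { intros r z Hr.
    rewrite <- (mode_function_ray (l - 1) (Dop l (trace g)) r z Hr).
    rewrite <- (mode_function_ray (l + 1) (Dop (- l) (trace g)) r z Hr).
    (* Only the occurrences of [g] under [dzeta] and [dzetabar] become mode functions; those inside
       [trace g] stay. *)
    rewrite <- (equivariant_mode_function l g He) at 1 3.
    assert (Ho : r <> 0 \/ 0 <> 0) by (left; lra).
    destruct (smooth_ray_derivatives (trace g) (sqrt (r ^ 2 + 0 ^ 2)) z
      (smooth_ray_trace g Hg) (radius_pos r 0 Ho)) as [D1 D2].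
    exact (has_partials_at_dzeta _ _ _ _ _ (mode_function_partials_off l (trace g) r 0 z Ho D1 D2)). }
  split; intros r z Hr; cbn [trace]; destruct (K r z Hr) as [E1 E2].
  - rewrite E1. transitivity ((RtoC (sqrt 2) * RtoC (/ sqrt 2)) * Dop l (trace g) (r, z))%C;
      [rewrite H2 |]; ring.
  - rewrite E2. transitivity ((RtoC (sqrt 2) * RtoC (/ sqrt 2)) * Dop (- l) (trace g) (r, z))%C;
      [rewrite H2 |]; ring.
Qed.

Lemma Dop_scal (l : Z) (s : C) (phi : R * R -> C) :
  smooth_ray phi -> eq_ray (Dop l (fun q => s * phi q)%C) (fun q => s * Dop l phi q)%C.
Proof.
  intros H r z Hr. rewrite !Dop_unfold.
  replace (drad (fun q => s * phi q)%C (r, z)) with (s * drad phi (r, z))%C; [ring |].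
  symmetry. apply is_cderive_unique, is_cderive_cst_mult.
  exact (proj1 (smooth_ray_derivatives phi r z H Hr)).
Qed.

Lemma equivariant_iter (j : Z) (a b c : nat) (f : R3 -> C) :
  smooth f -> equivariant j f ->
  equivariant (j - Z.of_nat a + Z.of_nat b)
    (Nat.iter b dzetabar (Nat.iter a dzeta (Nat.iter c dz f))).
Proof.
  intros Hs He. induction b as [| b IH].
  - replace (j - Z.of_nat a + Z.of_nat 0)%Z with (j - Z.of_nat a)%Z by lia.
    induction a as [| a IH].
    + replace (j - Z.of_nat 0)%Z with j by lia. induction c as [| c IH]; [exact He |].
      apply equivariant_dz; [apply (smooth_iter 0 0 c), Hs | exact IH].
    + replace (j - Z.of_nat (S a))%Z with (j - Z.of_nat a - 1)%Z by lia.
      apply equivariant_dzeta; [apply (smooth_iter a 0 c), Hs | exact IH].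
  - replace (j - Z.of_nat a + Z.of_nat (S b))%Z with (j - Z.of_nat a + Z.of_nat b + 1)%Z by lia.
    apply equivariant_dzetabar; [apply (smooth_iter a b c), Hs | exact IH].
Qed.

(** Each radial operator is [sqrt 2] times a zeta derivative on the trace; equivariance at every
    intermediate stage ensures that its index is the current mode, up to sign. *)
Lemma mixed_radial_trace (j : Z) (a b c : nat) (f : R3 -> C) :
  smooth f -> equivariant j f ->
  eq_ray (mixed_radial j (trace f) a b c)
    (fun q => RtoC (sqrt 2 ^ (a + b))
              * trace (Nat.iter b dzetabar (Nat.iter a dzeta (Nat.iter c dz f))) q)%C.
Proof.
  intros Hs He.
  assert (Ec : Nat.iter c dax (trace f) = trace (Nat.iter c dz f)).
  { induction c as [| c IH]; [reflexivity |]. simpl. rewrite IH.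
    apply functional_extensionality. intros [r z]. reflexivity. }
  induction b as [| b IH].
  - rewrite Nat.add_0_r. unfold mixed_radial. cbn [Dop_iter Nat.iter nat_rect]. rewrite Ec.
    induction a as [| a IH].
    + intros r z _. simpl. ring.
    + rewrite Dop_iter_S. eapply eq_ray_trans; [apply Dop_eq_ray, IH |].
      eapply eq_ray_trans; [apply Dop_scal, smooth_ray_trace, (smooth_iter a 0 c), Hs |].
      intros r z Hr.
      assert (E := equivariant_iter j a 0 c f Hs He).
      replace (j - Z.of_nat a + Z.of_nat 0)%Z with (j - Z.of_nat a)%Z in E by lia.
      rewrite (proj1 (trace_dzeta _ (Nat.iter a dzeta (Nat.iter c dz f))
        (smooth_iter a 0 c f Hs) E) r z Hr).
      simpl pow. rewrite RtoC_mult. simpl Nat.iter. ring.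
  - rewrite <- mixed_radial_S_r. eapply eq_ray_trans; [apply Dop_eq_ray, IH |].
    eapply eq_ray_trans; [apply Dop_scal, smooth_ray_trace, smooth_iter, Hs |].
    intros r z Hr.
    rewrite (proj2 (trace_dzeta _ _ (smooth_iter a b c f Hs) (equivariant_iter j a b c f Hs He)) r z Hr).
    rewrite Nat.add_succ_r. simpl pow. rewrite RtoC_mult. simpl Nat.iter. ring.
Qed.

Lemma radial_deriv_trace (j : Z) (i n p : nat) (f : R3 -> C) (r z : R) :
  smooth f -> equivariant j f -> 0 <= r ->
  radial_deriv j i n p (trace f) (r, z)
  = (RtoC (sqrt 2 ^ (i + (n - i)))
     * trace (Nat.iter (n - i) dzetabar (Nat.iter i dzeta (Nat.iter (p - n) dz f))) (r, z))%C.
Proof.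
  intros Hs He Hr.
  assert (E := mixed_radial_trace j i (n - i) (p - n) f Hs He).
  change (radial_deriv j i n p (trace f)) with
    (axis_ext (mixed_radial j (trace f) i (n - i) (p - n))).
  destruct Hr as [Hr | <-].
  - rewrite axis_ext_pos by exact Hr. apply E, Hr.
  (* The right-hand side is continuous up to the axis because [f] is smooth, so it supplies the
     limit that defines [axis_ext]. *)
  - apply axis_ext_limit.
    set (h := fun q => (RtoC (sqrt 2 ^ (i + (n - i)))
      * trace (Nat.iter (n - i) dzetabar (Nat.iter i dzeta (Nat.iter (p - n) dz f))) q)%C) in *.
    apply (filterlim_ext_loc (fun s => h (s, z))).
    + exists (mkposreal 1 Rlt_0_1). intros s _ Hs0. symmetry. apply E, Hs0.
    + apply (continuous_on_axis_limit 1); [lra |].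
      apply continuous_on_forall. intros q _. apply ccontinuous_mult; [apply continuous_const |].
      apply continuous_trace. intros u. apply smooth_continuous, smooth_iter, Hs.
Qed.

Lemma mode_test_radial_test (rad : R) (j : Z) (f : R3 -> C) :
  mode_test_function rad j f -> radial_test_function rad j (trace f).
Proof.
  intros [(Hs & r0 & z0 & Hr & Hz & Hsupp) Hm].
  assert (He := is_mode_equivariant j f Hm).
  assert (Hc : forall q : R * R, continuous (trace f) q).
  { intros q. apply continuous_trace. intros u. apply smooth_continuous, Hs. }
  split; [| split; [| split]].
  - exists r0, z0. split; [exact Hr | split; [exact Hz |]]. intros r z Hr0 H.
    apply Hsupp. intros [H1 H2].
    replace (r ^ 2 + 0 ^ 2) with (r ^ 2) in H1 by ring. rewrite sqrt_pow2 in H1 by exact Hr0. lra.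
  - intros m. apply smooth_ray_trace, Hs.
  - apply continuous_on_forall. intros q _. apply Hc.
  - intros i n p Hin Hnp. split.
    + apply (continuous_on_ext _ (fun q => RtoC (sqrt 2 ^ (i + (n - i)))
        * trace (Nat.iter (n - i) dzetabar (Nat.iter i dzeta (Nat.iter (p - n) dz f))) q)%C).
      * intros [r z] [Hr0 _]. symmetry. apply radial_deriv_trace; assumption.
      * apply continuous_on_forall. intros q _. apply ccontinuous_mult; [apply continuous_const |].
        apply continuous_trace. intros u. apply smooth_continuous, smooth_iter, Hs.
    + intros z. rewrite radial_deriv_trace by (assumption || lra). cbn [trace].
      (* The integer factor is the mode of the derivative: either it is 0, or the derivative
         vanishes on the axis by equivariance. *)
      destruct (Z.eq_dec (j + Z.of_nat n - 2 * Z.of_nat i) 0) as [-> | Hl]; [ring |].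
      rewrite (equivariant_axis (j - Z.of_nat i + Z.of_nat (n - i))).
      * ring.
      * apply equivariant_iter; assumption.
      * lia.
Qed.

Theorem lemma3p14 (X : CompleteNormedModule C_AbsRing) (rad : R) (k : Z)
  (i n p : nat) (rad_gt0 : 0 < rad) (le_in : (i <= n)%nat) (le_np : (n <= p)%nat)
  (T : mode_distribution rad k X)
  (S : mode_distribution rad (target_mode k i n) X) :
  (is_distributional_derivative i n p T S <->
   forall f, mode_test_function rad (target_mode k i n) f ->
     scal (sign_pow p) (T (zeta_deriv i n p f)) = S f)
  /\
  ((forall f, mode_test_function rad (target_mode k i n) f ->
     scal (sign_pow p) (T (zeta_deriv i n p f)) = S f) <->
   forall phi, radial_test_function rad (target_mode k i n) phi ->
     scal (sign_pow p)
       (radial_dist T (fun q : R * R =>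
          (RtoC (Rpower 2 (- (INR n / 2))) *
           axis_ext
             (Dop_iter i (- k + Z.of_nat i)
               (Dop_iter (n - i) (target_mode k i n)
                 (Nat.iter (p - n) dax phi))) q)%C))
     = radial_dist S phi).
Proof.
  split; [apply distributional_derivative_iff, le_in |]. unfold radial_dist. split.
  - intros H phi Hphi. rewrite <- (zeta_deriv_mode_function rad) by assumption.
    apply H, radial_test_mode_test, Hphi.
  - intros H f Hf. assert (Hphi := mode_test_radial_test _ _ _ Hf).
    (* The mode function of [trace f] is [f] itself, so testing on radial functions reaches every
       mode test function. *)
    specialize (H (trace f) Hphi).
    rewrite <- (zeta_deriv_mode_function rad), equivariant_mode_function in H; auto.
    apply is_mode_equivariant, Hf.
Qed.
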